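(* (Uniform signature property 1.) Let $p\ge 2$, $q\ge 1$ be coprime integers and consider the $(p,q)$-system with the Chebyshev solution $\{\varphi^{(j)}\}_{j=1}^p$. Let $a\in\mathbb Z/2p\mathbb Z$ and let $b$ be an integer with $0<b<q$, and put $\tau(L)=\frac{L}{pq}\pi i$. Then for all $j,l\in\{1,\dots,p\}$: (1) if $q>p$, then $(j|l)\in\mathcal J_{ar+b}$ if and only if $\partial_\tau\varphi^{(l,j)}(\tau(aq+b))=0$ and $\varphi^{(l,j)}(\tau(aq+b))<0$; (2) if $p>q$, then $(j|l)\in\mathcal J_{ar+b}$ if and only if $\partial_\tau\varphi^{(l,j)}(\tau(aq+b))=0$ and $\varphi^{(l,j)}(\tau(aq+b))>0$.
   Context: Setting: $r=p+q$, $\omega=e^{2\pi i/p}$, $\mu>0$, and $\beta=\beta_{p,q}$ is a nonzero real constant. The Chebyshev solution consists of the functions, for $j\in\{1,\dots,p\}$ (index mod $p$), $$\varphi^{(j)}(\tau)=\frac{p\,\beta\,\mu^{r/(2p)}}{2}\left[\frac{\cosh\big((p+q)(\tau-2\pi i\frac{j-1}{p})\big)}{p+q}-\frac{\cosh\big((q-p)(\tau-2\pi i\frac{j-1}{p})\big)}{q-p}\right],\qquad \tau\in\mathbb C,$$ and $\varphi^{(j,l)}=\varphi^{(j)}-\varphi^{(l)}$. The variable $\lambda$ is related to $\tau$ by $(2\lambda)^p=2\sqrt\mu\cosh(p\tau)$, where for large $|\lambda|$ one takes $\mathrm{Re}\,\tau>0$ and $e^{\tau}\sim 2\lambda\,\mu^{-1/(2p)}$.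 Then as $\lambda\to\infty$, $\varphi^{(j)}(\lambda)=\frac{p\beta}{4r}\,\omega^{-r(j-1)}(2\lambda)^r(1+o(1))$. Profile of dominant exponents: put $\chi_n=\frac{n\pi}{pr}$, $n\in\mathbb Z$. For each $n$ (mod $2rp$), $\mathcal J_n=(j_{n,1},\dots,j_{n,p})$ is the arrangement of $\{1,\dots,p\}$ such that $\mathrm{Re}\,\varphi^{(j_{n,1})}(\lambda)<\mathrm{Re}\,\varphi^{(j_{n,2})}(\lambda)<\cdots<\mathrm{Re}\,\varphi^{(j_{n,p})}(\lambda)$ as $\lambda\to\infty$ in the sector $\chi_n-\frac{\pi}{rp}<\arg\lambda<\chi_n$ (ordering determined by the leading terms). One writes $(j|l)\in\mathcal J_n$ (a ''parenthesis'') if $j=j_{n,i}$ and $l=j_{n,i+1}$ for some $i$, and the direction $\arg\lambda=\chi_n$ is a Stokes line of this pair, i.e. $\mathrm{Re}\big[(\omega^{-r(j-1)}-\omega^{-r(l-1)})e^{ir\chi_n}\big]=0$. *)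

(* Defs.v *)
(* Stdlib reals with Coquelicot's complex numbers [C]. *)
From Stdlib Require Export Reals ZArith Arith List Permutation Sorted.
From Coquelicot Require Export Coquelicot.
Export ListNotations.

Local Open Scope R_scope.


Definition Cexp (z : C) : C := (exp (Re z) * (cos (Im z), sin (Im z)))%C.

Definition Ccosh (z : C) : C := ((Cexp z + Cexp (- z)) / 2)%C.

(* Neighbourhoods of the point at infinity of the Riemann sphere. *)
Definition Cinfty (P : C -> Prop) : Prop :=
  exists M : R, forall z : C, M < Cmod z -> P z.

Definition Cnegative (z : C) : Prop := Im z = 0 /\ Re z < 0.
Definition Cpositive (z : C) : Prop := Im z = 0 /\ 0 < Re z.

Section ChebyshevSolution.

Variables (p q : nat) (beta mu : R).

Definition omega : C := Cexp (2 * PI * Ci / INR p).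

(* [omega_exp j] is [omega ^ (- r * (j - 1))], the phase of the leading term
   of the [j]-th function. *)
Definition omega_exp (j : nat) : C := (/ (omega ^ ((p + q) * (j - 1))))%C.

Definition phi (j : nat) (tau : C) : C :=
  let shifted := (tau - 2 * PI * Ci * (INR (j - 1) / INR p))%C in
  ((INR p * beta * Rpower mu ((INR p + INR q) / (2 * INR p)) / 2) *
   (Ccosh ((INR p + INR q)%R * shifted) / (INR p + INR q)%R
    - Ccosh ((INR q - INR p)%R * shifted) / (INR q - INR p)%R))%C.

Definition phi2 (j l : nat) (tau : C) : C := (phi j tau - phi l tau)%C.

(* [tau] as a function of [lambda] near infinity. This fixes [tau lambda] only
   up to multiples of [2 * PI * Ci], which do not change [phi j (tau lambda)];
   no continuity of [tau] itself can be asked around infinity. *)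
Definition is_tau (tau : C -> C) : Prop :=
  Cinfty (fun lambda =>
    ((2 * lambda) ^ p)%C = (2 * sqrt mu * Ccosh (INR p * tau lambda))%C
    /\ 0 < Re (tau lambda))
  /\ filterlim
       (fun lambda =>
          (Cexp (tau lambda) / (2 * lambda * Rpower mu (- / (2 * INR p))))%C)
       Cinfty (locally (RtoC 1)).

Definition chi (n : Z) : R := IZR n * PI / (INR p * INR (p + q)).

(* [J] is the arrangement of [1, ..., p] attached to the sector just before
   [chi n]. The limit is taken along each ray of the open sector: the leading
   terms have pairwise distinct real parts there, so they decide the order on
   every ray, but not uniformly up to the boundary directions. *)
Definition is_arrangement (n : Z) (J : list nat) : Prop :=
  Permutation J (seq 1 p) /\
  exists tau : C -> C, is_tau tau /\
    forall theta : R,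
      chi n - PI / (INR (p + q) * INR p) < theta < chi n ->
      Rbar_locally p_infty (fun rho : R =>
        let lambda := (rho * Cexp (Ci * theta))%C in
        Sorted (fun j l => Re (phi j (tau lambda)) < Re (phi l (tau lambda)))
          J).

Definition stokes_line (n : Z) (j l : nat) : Prop :=
  Re ((omega_exp j - omega_exp l) * Cexp (Ci * INR (p + q) * chi n)) = 0.

Definition parenthesis (n : Z) (j l : nat) : Prop :=
  (exists J : list nat, is_arrangement n J /\
     exists J1 J2 : list nat, J = J1 ++ j :: l :: J2)
  /\ stokes_line n j l.

Definition tau_at (L : Z) : C := (IZR L / (INR p * INR q) * PI * Ci)%C.

End ChebyshevSolution.

(* Main.v *)
Require Import Defs.
From Stdlib Require Import Lra Lia.
Local Open Scope R_scope.

(* With [r = p + q], [n = a r + b] and [L = a q + b], let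
   [A j = r chi_n - 2 pi r (j - 1) / p = pi (n - 2 r (j - 1)) / p].
   On a ray of the sector before [chi_n], at angular distance [delta / r] from it,
   [Re phi_j] is asymptotic to a common growing factor times [beta cos (A j - delta)],
   with [0 < delta < pi / p].  Half sums of angles lie in [(pi / p) Z], so
   differences of these leading terms keep their sign over the sector.  On a
   Stokes line of [(j|l)] the angles satisfy [A l = - A j] modulo [2 pi]; then no
   other leading term lies between those of [j] and [l], and [j] comes first iff
   [beta sin (A j) < 0].
   On the other side, [phi_j' = 2 K cosh (q s_j) sinh (p s_j)] with
   [s_j = tau - 2 pi i (j - 1) / p], and at [tau(L)] the factor [sinh (p s_j)] is
   nonzero and independent of [j], while [cosh (q s_j) = (-1)^a cos (A j)].
   Hence a critical point again means [A l = - A j], and there addition formulas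
   show that [phi_l - phi_j] has the sign of [(q - p) beta sin (A j)]. *)

(** * Complex exponential and hyperbolic cosine *)

Lemma C_ext (z w : C) : Re z = Re w -> Im z = Im w -> z = w.
Proof. destruct z, w; simpl; intros -> ->; reflexivity. Qed.

Lemma Re_mult (z w : C) : Re (z * w) = Re z * Re w - Im z * Im w.
Proof. reflexivity. Qed.

Lemma Im_mult (z w : C) : Im (z * w) = Re z * Im w + Im z * Re w.
Proof. reflexivity. Qed.

Lemma Re_Cexp (z : C) : Re (Cexp z) = exp (Re z) * cos (Im z).
Proof. destruct z; unfold Cexp; simpl; ring. Qed.

Lemma Im_Cexp (z : C) : Im (Cexp z) = exp (Re z) * sin (Im z).
Proof. destruct z; unfold Cexp; simpl; ring. Qed.

Lemma Cexp_plus (z w : C) : Cexp (z + w) = (Cexp z * Cexp w)%C.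
Proof.
  destruct z, w.
  apply C_ext; rewrite ?Re_mult, ?Im_mult, ?Re_Cexp, ?Im_Cexp; simpl;
    rewrite exp_plus, ?cos_plus, ?sin_plus; ring.
Qed.

Lemma Cexp_0 : Cexp 0 = 1.
Proof.
  apply C_ext; rewrite ?Re_Cexp, ?Im_Cexp; simpl;
    rewrite exp_0, ?cos_0, ?sin_0; ring.
Qed.

Lemma Re_Cexp_i (x : R) : Re (Cexp (Ci * x)) = cos x.
Proof.
  rewrite Re_Cexp. replace (Re (Ci * x)) with 0 by (simpl; ring).
  replace (Im (Ci * x)) with x by (simpl; ring). rewrite exp_0. ring.
Qed.

Lemma Im_Cexp_i (x : R) : Im (Cexp (Ci * x)) = sin x.
Proof.
  rewrite Im_Cexp. replace (Re (Ci * x)) with 0 by (simpl; ring).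
  replace (Im (Ci * x)) with x by (simpl; ring). rewrite exp_0. ring.
Qed.

Lemma Cmod_Cexp (z : C) : Cmod (Cexp z) = exp (Re z).
Proof.
  unfold Cmod. change (fst (Cexp z)) with (Re (Cexp z)).
  change (snd (Cexp z)) with (Im (Cexp z)).
  rewrite Re_Cexp, Im_Cexp.
  replace ((exp (Re z) * cos (Im z)) ^ 2 + (exp (Re z) * sin (Im z)) ^ 2)
    with (Rsqr (exp (Re z)) * (Rsqr (sin (Im z)) + Rsqr (cos (Im z))))
    by (unfold Rsqr; ring).
  rewrite sin2_cos2, Rmult_1_r. apply sqrt_Rsqr. left; apply exp_pos.
Qed.

Lemma Cexp_neq_0 (z : C) : Cexp z <> 0.
Proof.
  intro H. apply (f_equal Cmod) in H. rewrite Cmod_Cexp, Cmod_0 in H.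
  generalize (exp_pos (Re z)); lra.
Qed.

Lemma Cexp_opp (z : C) : Cexp (- z) = (/ Cexp z)%C.
Proof.
  assert (H : (Cexp z * Cexp (- z))%C = 1).
  { rewrite <- Cexp_plus. replace (z + - z)%C with (RtoC 0) by ring. apply Cexp_0. }
  replace (Cexp (- z)) with (/ Cexp z * (Cexp z * Cexp (- z)))%C
    by (field; apply Cexp_neq_0).
  rewrite H. ring.
Qed.

Lemma Cexp_pow (z : C) (n : nat) : (Cexp z ^ n)%C = Cexp (INR n * z).
Proof.
  induction n as [|n IH].
  - simpl. replace (0 * z)%C with (RtoC 0) by ring. now rewrite Cexp_0.
  - rewrite S_INR, RtoC_plus. simpl. rewrite IH.
    replace ((INR n + 1) * z)%C with (z + INR n * z)%C by ring.
    now rewrite Cexp_plus.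
Qed.

Lemma Re_scale (a : R) (z : C) : Re (a * z) = a * Re z.
Proof. rewrite Re_mult; simpl; ring. Qed.

Lemma Im_scale (a : R) (z : C) : Im (a * z) = a * Im z.
Proof. rewrite Im_mult; simpl; ring. Qed.

Lemma Cdiv_R (z : C) (a : R) : a <> 0 -> (z / a)%C = ((/ a)%R * z)%C.
Proof. intro H. rewrite RtoC_inv by exact H. unfold Cdiv. ring. Qed.

Lemma Re_Ccosh (z : C) : Re (Ccosh z) = cosh (Re z) * cos (Im z).
Proof.
  destruct z as [x y]. unfold Ccosh, cosh. rewrite Cdiv_R, Re_scale by lra.
  change (Re (?a + ?b)%C) with (Re a + Re b).
  rewrite !Re_Cexp. simpl. rewrite cos_neg. field.
Qed.

Lemma Im_Ccosh (z : C) : Im (Ccosh z) = sinh (Re z) * sin (Im z).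
Proof.
  destruct z as [x y]. unfold Ccosh, sinh. rewrite Cdiv_R, Im_scale by lra.
  change (Im (?a + ?b)%C) with (Im a + Im b).
  rewrite !Im_Cexp. simpl. rewrite sin_neg. field.
Qed.

(** * Real and imaginary parts of the Chebyshev functions *)

Definition phi_coeff (p q : nat) (beta mu : R) : R :=
  INR p * beta * Rpower mu ((INR p + INR q) / (2 * INR p)) / 2.

Definition shift (p j : nat) : R := 2 * PI * (INR (j - 1) / INR p).

Lemma phi_shift (p j : nat) (hp : (1 <= p)%nat) (tau : C) :
  (tau - 2 * PI * Ci * (INR (j - 1) / INR p))%C = (tau - shift p j * Ci)%C.
Proof.
  assert (INR p <> 0) by (apply not_0_INR; lia).
  unfold shift. rewrite !RtoC_mult, RtoC_div by assumption. ring.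
Qed.

Lemma RtoC_neq_0 (a : R) : a <> 0 -> RtoC a <> 0.
Proof. intros H E. apply H. now apply RtoC_inj. Qed.

Lemma phi_eq (p q : nat) (beta mu : R) (j : nat) (tau : C) :
  (1 <= p)%nat -> p <> q ->
  phi p q beta mu j tau =
  (phi_coeff p q beta mu *
   ((/ (INR p + INR q))%R * Ccosh ((INR p + INR q)%R * (tau - shift p j * Ci))
    - (/ (INR q - INR p))%R * Ccosh ((INR q - INR p)%R * (tau - shift p j * Ci))))%C.
Proof.
  intros hp hpq.
  assert (INR q <> INR p) by (intro E; apply INR_eq in E; lia).
  assert (0 < INR p) by (apply lt_0_INR; lia).
  assert (0 <= INR q) by apply pos_INR.
  unfold phi. rewrite phi_shift by exact hp. unfold phi_coeff.
  rewrite !RtoC_div, !RtoC_mult by lra.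
  rewrite !Cdiv_R by lra. f_equal.
Qed.

Lemma Re_phi (p q : nat) (beta mu : R) (j : nat) (tau : C) :
  (1 <= p)%nat -> p <> q ->
  Re (phi p q beta mu j tau) =
  phi_coeff p q beta mu *
  (cosh ((INR p + INR q) * Re tau) * cos ((INR p + INR q) * (Im tau - shift p j))
     / (INR p + INR q)
   - cosh ((INR q - INR p) * Re tau) * cos ((INR q - INR p) * (Im tau - shift p j))
     / (INR q - INR p)).
Proof.
  intros hp hpq. rewrite phi_eq by assumption.
  rewrite Re_scale.
  change (Re (?a - ?b)%C) with (Re a - Re b).
  rewrite !Re_scale, !Re_Ccosh, !Re_scale, !Im_scale.
  replace (Re (tau - shift p j * Ci)) with (Re tau) by (destruct tau; simpl; ring).
  replace (Im (tau - shift p j * Ci)) with (Im tau - shift p j) by (destruct tau; simpl; ring).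
  unfold Rdiv. ring.
Qed.

Lemma Im_phi (p q : nat) (beta mu : R) (j : nat) (tau : C) :
  (1 <= p)%nat -> p <> q ->
  Im (phi p q beta mu j tau) =
  phi_coeff p q beta mu *
  (sinh ((INR p + INR q) * Re tau) * sin ((INR p + INR q) * (Im tau - shift p j))
     / (INR p + INR q)
   - sinh ((INR q - INR p) * Re tau) * sin ((INR q - INR p) * (Im tau - shift p j))
     / (INR q - INR p)).
Proof.
  intros hp hpq. rewrite phi_eq by assumption.
  rewrite Im_scale.
  change (Im (?a - ?b)%C) with (Im a - Im b).
  rewrite !Im_scale, !Im_Ccosh, !Re_scale, !Im_scale.
  replace (Re (tau - shift p j * Ci)) with (Re tau) by (destruct tau; simpl; ring).
  replace (Im (tau - shift p j * Ci)) with (Im tau - shift p j) by (destruct tau; simpl; ring).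
  unfold Rdiv. ring.
Qed.

(** * Complex derivatives by explicit estimates *)

Definition Cderiv (f : C -> C) (z l : C) : Prop :=
  forall eps : R, 0 < eps -> exists delta : R, 0 < delta /\
    forall y : C, Cmod (y - z) < delta ->
      Cmod (f y - f z - (y - z) * l) <= eps * Cmod (y - z).

Lemma Cderiv_is_derive (f : C -> C) (z l : C) :
  Cderiv f z l -> is_derive (K := C_AbsRing) (V := C_NormedModule) f z l.
Proof.
  intro H. split; [apply is_linear_scal_l|].
  intros x Hx eps. 
  (* The derivative asks for the estimate at every limit [x] of the filter [locally z]; limits are
     unique, so [x] is [z]. *)
  assert (E := is_filter_lim_locally_unique (V := AbsRing_NormedModule C_AbsRing) z x Hx).
  subst x.
  destruct (H eps (cond_pos eps)) as [delta [Hd Hy]].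
  exists (mkposreal delta Hd). exact Hy.
Qed.

Lemma Cderiv_minus (f g : C -> C) (z l m : C) :
  Cderiv f z l -> Cderiv g z m -> Cderiv (fun x => f x - g x)%C z (l - m).
Proof.
  intros Hf Hg eps Heps.
  destruct (Hf (eps / 2)) as [d1 [Hd1 H1]]; [lra|].
  destruct (Hg (eps / 2)) as [d2 [Hd2 H2]]; [lra|].
  exists (Rmin d1 d2). split; [now apply Rmin_glb_lt|]. intros y Hy.
  replace (f y - g y - (f z - g z) - (y - z) * (l - m))%C
    with ((f y - f z - (y - z) * l) + - (g y - g z - (y - z) * m))%C by ring.
  eapply Rle_trans; [apply Cmod_triangle|]. rewrite Cmod_opp.
  specialize (H1 y (Rlt_le_trans _ _ _ Hy (Rmin_l _ _))).
  specialize (H2 y (Rlt_le_trans _ _ _ Hy (Rmin_r _ _))). lra.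
Qed.

Lemma Cderiv_scal (f : C -> C) (z l k : C) :
  Cderiv f z l -> Cderiv (fun x => k * f x)%C z (k * l).
Proof.
  intros Hf eps Heps. assert (Hk := Cmod_ge_0 k).
  destruct (Hf (eps / (Cmod k + 1))) as [d [Hd H]].
  { apply Rdiv_lt_0_compat; lra. }
  exists d. split; [exact Hd|]. intros y Hy.
  replace (k * f y - k * f z - (y - z) * (k * l))%C
    with (k * (f y - f z - (y - z) * l))%C by ring.
  rewrite Cmod_mult. specialize (H y Hy).
  replace (eps * Cmod (y - z)) with ((Cmod k + 1) * (eps / (Cmod k + 1) * Cmod (y - z)))
    by (field; lra).
  apply Rmult_le_compat; try apply Cmod_ge_0; lra.
Qed.

Lemma Cderiv_comp_affine (f : C -> C) (z k d l : C) :
  Cderiv f (k * z + d) l -> Cderiv (fun x => f (k * x + d))%C z (k * l).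
Proof.
  intros Hf eps Heps. assert (Hk := Cmod_ge_0 k).
  destruct (Hf (eps / (Cmod k + 1))) as [e [He H]].
  { apply Rdiv_lt_0_compat; lra. }
  exists (e / (Cmod k + 1)). split; [apply Rdiv_lt_0_compat; lra|]. intros y Hy.
  assert (E : (k * y + d - (k * z + d))%C = (k * (y - z))%C) by ring.
  specialize (H (k * y + d)%C). rewrite E, Cmod_mult in H.
  replace ((y - z) * (k * l))%C with (k * (y - z) * l)%C by ring.
  assert (Hyz := Cmod_ge_0 (y - z)).
  assert (B : (Cmod k + 1) * Cmod (y - z) < e).
  { replace e with ((Cmod k + 1) * (e / (Cmod k + 1))) by (field; lra).
    apply Rmult_lt_compat_l; lra. }
  eapply Rle_trans; [apply H; nra|].
  replace (eps * Cmod (y - z)) with (eps / (Cmod k + 1) * ((Cmod k + 1) * Cmod (y - z)))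
    by (field; lra).
  apply Rmult_le_compat_l; [left; apply Rdiv_lt_0_compat; lra | nra].
Qed.

Lemma Cderiv_plus (f g : C -> C) (z l m : C) :
  Cderiv f z l -> Cderiv g z m -> Cderiv (fun x => f x + g x)%C z (l + m).
Proof.
  intros Hf Hg eps Heps.
  destruct (Hf (eps / 2)) as [d1 [Hd1 H1]]; [lra|].
  destruct (Hg (eps / 2)) as [d2 [Hd2 H2]]; [lra|].
  exists (Rmin d1 d2). split; [now apply Rmin_glb_lt|]. intros y Hy.
  replace (f y + g y - (f z + g z) - (y - z) * (l + m))%C
    with ((f y - f z - (y - z) * l) + (g y - g z - (y - z) * m))%C by ring.
  eapply Rle_trans; [apply Cmod_triangle|].
  specialize (H1 y (Rlt_le_trans _ _ _ Hy (Rmin_l _ _))).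
  specialize (H2 y (Rlt_le_trans _ _ _ Hy (Rmin_r _ _))). lra.
Qed.

Lemma derivable_pt_lim_0_bound (f : R -> R) (l eps : R) :
  derivable_pt_lim f 0 l -> 0 < eps ->
  exists delta : R, 0 < delta /\
    forall h, Rabs h < delta -> Rabs (f h - f 0 - l * h) <= eps * Rabs h.
Proof.
  intros Hf Heps. destruct (Hf eps Heps) as [[delta Hd] H]. exists delta.
  split; [exact Hd|]. intros h Hh. destruct (Req_dec h 0) as [->|Hh0].
  - replace (f 0 - f 0 - l * 0) with 0 by ring. rewrite Rabs_R0. lra.
  - specialize (H h Hh0 Hh). rewrite Rplus_0_l in H.
    replace (f h - f 0 - l * h) with (((f h - f 0) / h - l) * h) by (field; exact Hh0).
    rewrite Rabs_mult. apply Rmult_le_compat_r; [apply Rabs_pos | lra].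
Qed.

Lemma Cmod_le_Rabs (z : C) : Cmod z <= Rabs (Re z) + Rabs (Im z).
Proof.
  replace z with (Re z + Im z * Ci)%C at 1.
  - eapply Rle_trans; [apply Cmod_triangle|].
    rewrite Cmod_mult, !Cmod_R.
    replace (Cmod Ci) with 1; [lra|].
    unfold Cmod, Ci; simpl. replace (0 * (0 * 1) + 1 * (1 * 1)) with 1 by ring.
    now rewrite sqrt_1.
  - destruct z; apply C_ext; simpl; ring.
Qed.

Lemma Rabs_Im_le_Cmod (z : C) : Rabs (Im z) <= Cmod z.
Proof. eapply Rle_trans; [apply Rmax_r | apply Rmax_Cmod]. Qed.

(** For [h = a + i b] the remainder has real part [(e^a - 1 - a) + e^a (cos b - 1)] and imaginary
    part [e^a (sin b - b) + (e^a - 1) b], so the real derivatives of [exp], [sin] and [cos] at 0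
    control it. *)
Lemma Cexp_remainder (eps : R) : 0 < eps ->
  exists delta : R, 0 < delta /\
    forall h : C, Cmod h < delta -> Cmod (Cexp h - 1 - h) <= eps * Cmod h.
Proof.
  (* The four terms will add up to at most [7 e |h|], whence [eps / 8]; the bound [1 / 2] ensures
     [exp a <= 2]. *)
  intro Heps. set (e := Rmin (eps / 8) (1 / 2)).
  assert (He : 0 < e) by (apply Rmin_glb_lt; lra).
  assert (He1 : e <= eps / 8) by apply Rmin_l.
  assert (He2 : e <= 1 / 2) by apply Rmin_r.
  destruct (derivable_pt_lim_0_bound exp 1 e) as [d1 [Hd1 H1]]; [|exact He|].
  { rewrite <- exp_0. apply derivable_pt_lim_exp. }
  destruct (derivable_pt_lim_0_bound sin 1 e) as [d2 [Hd2 H2]]; [|exact He|].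
  { rewrite <- cos_0. apply derivable_pt_lim_sin. }
  destruct (derivable_pt_lim_0_bound cos 0 e) as [d3 [Hd3 H3]]; [|exact He|].
  { replace 0 with (- sin 0) at 2 by (rewrite sin_0; ring). apply derivable_pt_lim_cos. }
  exists (Rmin e (Rmin d1 (Rmin d2 d3))). split.
  { repeat (apply Rmin_glb_lt; [assumption|]); assumption. }
  intros [a b] Hh.
  assert (Ha := re_le_Cmod (a, b)). assert (Hb := Rabs_Im_le_Cmod (a, b)).
  simpl in Ha, Hb. set (m := Cmod (a, b)) in *.
  assert (Hm0 : 0 <= m) by apply Cmod_ge_0.
  assert (Hme : m < e) by (eapply Rlt_le_trans; [exact Hh | apply Rmin_l]).
  assert (Hm' : m < Rmin d1 (Rmin d2 d3)) by (eapply Rlt_le_trans; [exact Hh | apply Rmin_r]).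
  assert (Hm1 : m < d1) by (eapply Rlt_le_trans; [exact Hm' | apply Rmin_l]).
  assert (Hm'' : m < Rmin d2 d3) by (eapply Rlt_le_trans; [exact Hm' | apply Rmin_r]).
  assert (Hm2 : m < d2) by (eapply Rlt_le_trans; [exact Hm'' | apply Rmin_l]).
  assert (Hm3 : m < d3) by (eapply Rlt_le_trans; [exact Hm'' | apply Rmin_r]).
  specialize (H1 a ltac:(lra)). specialize (H2 b ltac:(lra)). specialize (H3 b ltac:(lra)).
  rewrite exp_0 in H1. rewrite sin_0 in H2. rewrite cos_0 in H3.
  assert (K1 : Rabs (exp a - 1 - 1 * a) <= e * m) by (eapply Rle_trans; [exact H1 | nra]).
  assert (K2 : Rabs (sin b - 0 - 1 * b) <= e * m) by (eapply Rle_trans; [exact H2 | nra]).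
  assert (K3 : Rabs (cos b - 1 - 0 * b) <= e * m) by (eapply Rle_trans; [exact H3 | nra]).
  clear H1 H2 H3.
  apply Rabs_le_between in K1, Ha.
  assert (Hexp : 0 < exp a <= 2) by (split; [apply exp_pos | nra]).
  assert (Hexp1 : Rabs (exp a - 1) <= 2 * e) by (apply Rabs_le; nra).
  eapply Rle_trans; [apply Cmod_le_Rabs|].
  replace (Re (Cexp (a, b) - 1 - (a, b)))
    with ((exp a - 1 - 1 * a) + exp a * (cos b - 1 - 0 * b))
    by (simpl; ring).
  replace (Im (Cexp (a, b) - 1 - (a, b)))
    with (exp a * (sin b - 0 - 1 * b) + (exp a - 1) * b)
    by (simpl; ring).
  assert (T1 := Rabs_triang (exp a - 1 - 1 * a) (exp a * (cos b - 1 - 0 * b))).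
  assert (T2 := Rabs_triang (exp a * (sin b - 0 - 1 * b)) ((exp a - 1) * b)).
  rewrite Rabs_mult, (Rabs_pos_eq (exp a)) in T1 by lra.
  rewrite !Rabs_mult, (Rabs_pos_eq (exp a)) in T2 by lra.
  assert (P1 : exp a * Rabs (cos b - 1 - 0 * b) <= 2 * (e * m))
    by (apply Rmult_le_compat; try lra; apply Rabs_pos).
  assert (P2 : exp a * Rabs (sin b - 0 - 1 * b) <= 2 * (e * m))
    by (apply Rmult_le_compat; try lra; apply Rabs_pos).
  assert (P3 : Rabs (exp a - 1) * Rabs b <= 2 * e * m)
    by (apply Rmult_le_compat; try lra; apply Rabs_pos).
  assert (P4 : Rabs (exp a - 1 - 1 * a) <= e * m) by (apply Rabs_le; lra).
  nra.
Qed.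

Lemma Cderiv_Cexp (z : C) : Cderiv Cexp z (Cexp z).
Proof.
  intros eps Heps. assert (Hz := exp_pos (Re z)).
  destruct (Cexp_remainder (eps / exp (Re z))) as [d [Hd H]].
  { now apply Rdiv_lt_0_compat. }
  exists d. split; [exact Hd|]. intros y Hy.
  replace y with (z + (y - z))%C at 1 by ring. rewrite Cexp_plus.
  replace (Cexp z * Cexp (y - z) - Cexp z - (y - z) * Cexp z)%C
    with (Cexp z * (Cexp (y - z) - 1 - (y - z)))%C by ring.
  rewrite Cmod_mult, Cmod_Cexp.
  replace (eps * Cmod (y - z)) with (exp (Re z) * (eps / exp (Re z) * Cmod (y - z)))
    by (field; lra).
  apply Rmult_le_compat_l; [lra | now apply H].
Qed.

Lemma Cderiv_Ccosh_affine (z k s : C) :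
  Cderiv (fun x => Ccosh (k * (x - s))) z
    (k * ((Cexp (k * (z - s)) - Cexp (- (k * (z - s)))) / 2)).
Proof.
  assert (H1 := Cderiv_comp_affine Cexp z k (- (k * s)) _ (Cderiv_Cexp _)).
  assert (H2 := Cderiv_comp_affine Cexp z (- k) (k * s) _ (Cderiv_Cexp _)).
  assert (H := Cderiv_scal _ _ _ (/ 2)%C (Cderiv_plus _ _ _ _ _ H1 H2)).
  replace (k * z + - (k * s))%C with (k * (z - s))%C in H by ring.
  replace (- k * z + k * s)%C with (- (k * (z - s)))%C in H by ring.
  intros eps Heps. destruct (H eps Heps) as [d [Hd H']]. exists d. split; [exact Hd|].
  intros y Hy. specialize (H' y Hy). unfold Ccosh.
  eapply Rle_trans; [right | exact H'].
  replace (k * y + - (k * s))%C with (k * (y - s))%C by ring.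
  replace (- k * y + k * s)%C with (- (k * (y - s)))%C by ring.
  replace (k * z + - (k * s))%C with (k * (z - s))%C by ring.
  replace (- k * z + k * s)%C with (- (k * (z - s)))%C by ring.
  f_equal. field.
Qed.


(** * Sorting by a real key *)

Section Sorting.

Variables (A : Type) (f : A -> R).

Let lt_f (x y : A) : Prop := f x < f y.

Lemma insert_sorted (x : A) (l : list A) :
  StronglySorted lt_f l -> (forall y, In y l -> f x <> f y) ->
  exists l', Permutation (x :: l) l' /\ StronglySorted lt_f l'.
Proof.
  induction l as [|y l IH]; intros Hs Hx.
  - exists [x]. split; [apply Permutation_refl|].
    constructor; constructor.
  - inversion_clear Hs as [|? ? Hl Hy]. destruct (Rtotal_order (f x) (f y)) as [H|[H|H]].
    + exists (x :: y :: l). split; [apply Permutation_refl|].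
      constructor; [now constructor|]. constructor; [exact H|].
      eapply Forall_impl; [|exact Hy]. unfold lt_f. intros; lra.
    + destruct (Hx y (or_introl eq_refl) H).
    + destruct IH as [l' [Hp Hs']]; [exact Hl | intros; apply Hx; now right |].
      exists (y :: l'). split.
      * eapply perm_trans; [apply perm_swap|]. now apply perm_skip.
      * constructor; [exact Hs'|].
        eapply Permutation_Forall; [exact Hp|]. now constructor.
Qed.

(** Pairwise distinct keys make the strict order total on the list, which is what insertion sort
    needs to give a strictly sorted result. *)
Lemma sort_exists (l : list A) :
  NoDup l -> (forall x y, In x l -> In y l -> x <> y -> f x <> f y) ->
  exists l', Permutation l l' /\ StronglySorted lt_f l'.
Proof.
  induction l as [|x l IH]; intros Hnd Hf.
  - exists []. split; constructor.
  - inversion_clear Hnd as [|? ? Hx Hl].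
    destruct IH as [l' [Hp Hs]]; [exact Hl | intros; apply Hf; simpl; auto |].
    destruct (insert_sorted x l' Hs) as [l'' [Hp' Hs']].
    + intros y Hy. assert (In y l) by (eapply Permutation_in; [symmetry; exact Hp | exact Hy]).
      apply Hf; simpl; auto. intros ->; contradiction.
    + exists l''. split; [|exact Hs'].
      eapply perm_trans; [apply perm_skip, Hp | exact Hp'].
Qed.

(** Once [x] is at the head, the next element has a key above that of [x]; were it not [y], it would
    lie strictly between the two. *)
Lemma sorted_adjacent (l : list A) (x y : A) :
  StronglySorted lt_f l -> In x l -> In y l -> f x < f y ->
  (forall z, In z l -> ~ (f x < f z /\ f z < f y)) ->
  exists l1 l2, l = l1 ++ x :: y :: l2.
Proof.
  induction l as [|z l IH]; intros Hs Hx Hy Hxy Hz; [destruct Hx|].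
  inversion_clear Hs as [|? ? Hl Hf]. rewrite Forall_forall in Hf.
  destruct Hx as [->|Hx].
  - destruct Hy as [->|Hy]; [lra|].
    destruct l as [|w l]; [destruct Hy|].
    destruct Hy as [->|Hy]; [now exists [], l|].
    inversion_clear Hl as [|? ? _ Hw]. rewrite Forall_forall in Hw.
    destruct (Hz w); [simpl; auto|]. split.
    + apply Hf; simpl; auto.
    + now apply Hw.
  - destruct Hy as [->|Hy].
    + specialize (Hf x Hx). unfold lt_f in Hf. lra.
    + destruct (IH Hl Hx Hy Hxy) as [l1 [l2 ->]].
      * intros w Hw. apply Hz. now right.
      * now exists (z :: l1), l2.
Qed.

End Sorting.

Lemma Sorted_adjacent_rel {A : Type} (R : A -> A -> Prop) (l1 l2 : list A) (x y : A) :
  Sorted R (l1 ++ x :: y :: l2) -> R x y.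
Proof.
  induction l1 as [|z l1 IH]; simpl; intro Hs; apply Sorted_inv in Hs; destruct Hs as [Hs H].
  - now inversion H.
  - auto.
Qed.

(** * Sign of the sine on a grid *)

Lemma cos_IZR_PI_sqr (d : Z) : cos (IZR d * PI) * cos (IZR d * PI) = 1.
Proof.
  assert (H : sin (IZR d * PI) = 0) by (apply sin_eq_0_1; now exists d).
  generalize (sin2_cos2 (IZR d * PI)). unfold Rsqr. rewrite H. lra.
Qed.

Lemma sin_shift_PI (x : R) (d : Z) :
  sin (x + IZR d * PI) = cos (IZR d * PI) * sin x.
Proof.
  rewrite sin_plus.
  assert (H : sin (IZR d * PI) = 0) by (apply sin_eq_0_1; now exists d).
  rewrite H. ring.
Qed.

Lemma cos_shift_PI (x : R) (d : Z) :
  cos (x + IZR d * PI) = cos (IZR d * PI) * cos x.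
Proof.
  rewrite cos_plus.
  assert (H : sin (IZR d * PI) = 0) by (apply sin_eq_0_1; now exists d).
  rewrite H. ring.
Qed.

Lemma cos_IZR_2PI (d : Z) : cos (IZR (2 * d) * PI) = 1.
Proof.
  replace (IZR (2 * d) * PI) with (2 * (IZR d * PI)) by (rewrite mult_IZR; ring).
  rewrite cos_2a_cos, Rmult_assoc, cos_IZR_PI_sqr. ring.
Qed.

Section SinGrid.

Variables (p : nat) (hp : (1 <= p)%nat).

Let INRp_pos : 0 < INR p.
Proof. apply lt_0_INR; lia. Qed.

Lemma sin_grid_zero (m : Z) :
  sin (PI * IZR m / INR p) = 0 <-> (Z.of_nat p | m)%Z.
Proof.
  split.
  - intro H. destruct (sin_eq_0_0 _ H) as [k Hk]. exists k.
    apply eq_IZR. rewrite mult_IZR, <- INR_IZR_INZ.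
    assert (PI <> 0) by apply PI_neq0.
    apply Rmult_eq_reg_l with PI; [|assumption].
    transitivity (PI * IZR m / INR p * INR p); [field; lra|]. rewrite Hk. ring.
  - intros [k ->]. apply sin_eq_0_1. exists k.
    rewrite mult_IZR, <- INR_IZR_INZ. field. lra.
Qed.

(* The zeros of [sin] are multiples of [PI], hence grid points: [sin] keeps its
   sign on each cell of the grid of step [PI / p]. *)
Lemma cell_in_half_period (m : Z) :
  exists d : Z, IZR d * PI <= PI * IZR (m - 1) / INR p /\
    PI * IZR m / INR p <= IZR d * PI + PI.
Proof.
  exists ((m - 1) / Z.of_nat p)%Z.
  assert (Hpi := PI_RGT_0).
  pose proof (Z.div_mod (m - 1) (Z.of_nat p) ltac:(lia)) as H1.
  pose proof (Z.mod_pos_bound (m - 1) (Z.of_nat p) ltac:(lia)) as H2.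
  set (d := ((m - 1) / Z.of_nat p)%Z) in *. split.
  - apply Rmult_le_reg_r with (INR p); [lra|].
    replace (PI * IZR (m - 1) / INR p * INR p) with (PI * IZR (m - 1)) by (field; lra).
    rewrite INR_IZR_INZ.
    replace (IZR d * PI * IZR (Z.of_nat p)) with (PI * (IZR d * IZR (Z.of_nat p))) by ring.
    apply Rmult_le_compat_l; [lra|]. rewrite <- mult_IZR. apply IZR_le. nia.
  - apply Rmult_le_reg_r with (INR p); [lra|].
    replace (PI * IZR m / INR p * INR p) with (PI * IZR m) by (field; lra).
    rewrite INR_IZR_INZ.
    replace ((IZR d * PI + PI) * IZR (Z.of_nat p))
      with (PI * ((IZR d + 1) * IZR (Z.of_nat p))) by ring.
    apply Rmult_le_compat_l; [lra|].
    rewrite <- (plus_IZR d 1), <- mult_IZR. apply IZR_le. nia.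
Qed.

(** A shift by [d PI] brings both arguments into [[0, PI]], and the two signs [cos (d PI)] multiply
    to 1. The cell is closed because one argument will be a grid point itself. *)
Lemma sin_cell_ge0 (m : Z) (x y : R) :
  PI * IZR (m - 1) / INR p <= x <= PI * IZR m / INR p ->
  PI * IZR (m - 1) / INR p <= y <= PI * IZR m / INR p ->
  0 <= sin x * sin y.
Proof.
  intros Hx Hy.
  destruct (cell_in_half_period m) as [d Hd].
  replace x with ((x - IZR d * PI) + IZR d * PI) by ring.
  replace y with ((y - IZR d * PI) + IZR d * PI) by ring.
  rewrite !sin_shift_PI.
  replace (cos (IZR d * PI) * sin (x - IZR d * PI) * (cos (IZR d * PI) * sin (y - IZR d * PI)))
    with ((cos (IZR d * PI) * cos (IZR d * PI)) * (sin (x - IZR d * PI) * sin (y - IZR d * PI)))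
    by ring.
  rewrite cos_IZR_PI_sqr, Rmult_1_l.
  apply Rmult_le_pos; apply sin_ge_0; lra.
Qed.

Lemma sin_cell_neq0 (m : Z) (x : R) :
  PI * IZR (m - 1) / INR p < x < PI * IZR m / INR p -> sin x <> 0.
Proof.
  intros Hx. destruct (cell_in_half_period m) as [d Hd].
  replace x with ((x - IZR d * PI) + IZR d * PI) by ring.
  rewrite sin_shift_PI. apply Rmult_integral_contrapositive_currified.
  - intro E. generalize (cos_IZR_PI_sqr d). rewrite E. lra.
  - apply Rgt_not_eq, sin_gt_0; lra.
Qed.

Lemma sin_cell_gt0 (m : Z) (x y : R) :
  PI * IZR (m - 1) / INR p < x < PI * IZR m / INR p ->
  PI * IZR (m - 1) / INR p < y < PI * IZR m / INR p ->
  0 < sin x * sin y.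
Proof.
  intros Hx Hy. destruct (sin_cell_ge0 m x y) as [H|H]; [lra | lra | exact H |].
  symmetry in H. destruct (Rmult_integral _ _ H) as [E|E].
  - destruct (sin_cell_neq0 m x Hx E).
  - destruct (sin_cell_neq0 m y Hy E).
Qed.

End SinGrid.

(** * Order of the leading terms *)

(* The argument, in the direction [chi n], of the leading term of the [j]-th function
   (up to the sign of [beta]). *)
Definition lead_angle (p q : nat) (n : Z) (j : nat) : R :=
  PI * IZR (n - 2 * Z.of_nat (p + q) * Z.of_nat (j - 1)) / INR p.

Definition profile_key (p q : nat) (beta : R) (n : Z) (delta : R) (j : nat) : R :=
  beta * cos (lead_angle p q n j - delta).

(** The two phases are complex conjugate. For distinct indices this is the Stokes condition. *)
Definition reflected (p q : nat) (n : Z) (j l : nat) : Prop :=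
  exists d : Z, lead_angle p q n j + lead_angle p q n l = IZR (2 * d) * PI.

(** The middle term of the whole equivalence: parentheses and critical points of the right sign are
    each shown equivalent to it. *)
Definition neighbours (p q : nat) (beta : R) (n : Z) (j l : nat) : Prop :=
  reflected p q n j l /\ beta * sin (lead_angle p q n j) < 0.

Section Profile.

Variables (p q : nat) (beta : R) (n : Z).
Hypothesis hp : (1 <= p)%nat.
Hypothesis hpq : Nat.gcd p q = 1%nat.
Hypothesis hbeta : beta <> 0.

Notation angle := (lead_angle p q n).
Notation key := (profile_key p q beta n).

Let INRp_pos : 0 < INR p.
Proof. apply lt_0_INR; lia. Qed.

(** The angles of [j] and [l] share the same [n], and their other terms are even, so halving the sum
    stays on the grid of step [PI / p]. *)
Lemma half_sum_angle (j l : nat) :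
  (angle j + angle l) / 2 =
  PI * IZR (n - Z.of_nat (p + q) * (Z.of_nat (j - 1) + Z.of_nat (l - 1))) / INR p.
Proof.
  unfold lead_angle. rewrite !minus_IZR, !mult_IZR, plus_IZR. field. lra.
Qed.

Lemma half_diff_angle (j l : nat) :
  (angle j - angle l) / 2 =
  PI * IZR (Z.of_nat (p + q) * (Z.of_nat (l - 1) - Z.of_nat (j - 1))) / INR p.
Proof.
  unfold lead_angle. rewrite !minus_IZR, !mult_IZR, !minus_IZR. field. lra.
Qed.

(** Modulo [p] the factor [p + q] is [q], which Bezout inverts: if [x p = 1 + y q] then
    [m = x p m - y q m], and [p] divides both terms. *)
Lemma coprime_dvd_mul (m : Z) :
  (Z.of_nat p | Z.of_nat (p + q) * m)%Z -> (Z.of_nat p | m)%Z.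
Proof.
  intros [k Hk]. destruct (Nat.gcd_bezout_pos p q) as [x [y Hxy]]; [lia|].
  rewrite hpq in Hxy. exists (Z.of_nat x * m - Z.of_nat y * (k - m))%Z.
  rewrite Nat2Z.inj_add in Hk.
  assert (Hq : (Z.of_nat q * m = (k - m) * Z.of_nat p)%Z) by lia.
  assert (HZ : (Z.of_nat x * Z.of_nat p = 1 + Z.of_nat y * Z.of_nat q)%Z) by lia.
  transitivity (Z.of_nat x * Z.of_nat p * m - Z.of_nat y * (Z.of_nat q * m))%Z.
  - rewrite HZ. ring.
  - rewrite Hq. ring.
Qed.

Lemma dvd_small_eq (j l : nat) :
  (1 <= j <= p)%nat -> (1 <= l <= p)%nat ->
  (Z.of_nat p | Z.of_nat (l - 1) - Z.of_nat (j - 1))%Z -> j = l.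
Proof. intros hj hl [k Hk]. assert (k = 0%Z) by nia. lia. Qed.

Lemma sin_half_diff_neq0 (j l : nat) :
  (1 <= j <= p)%nat -> (1 <= l <= p)%nat -> j <> l ->
  sin ((angle j - angle l) / 2) <> 0.
Proof.
  intros hj hl Hjl H. rewrite half_diff_angle in H.
  apply sin_grid_zero in H; [|exact hp].
  apply Hjl, dvd_small_eq; try assumption. now apply coprime_dvd_mul.
Qed.

Lemma key_diff (delta : R) (j l : nat) :
  key delta j - key delta l =
  - 2 * beta * sin ((angle j - angle l) / 2) * sin ((angle j + angle l) / 2 - delta).
Proof.
  unfold profile_key. rewrite <- Rmult_minus_distr_l, form2.
  replace ((angle j - delta - (angle l - delta)) / 2) with ((angle j - angle l) / 2) by field.
  replace ((angle j - delta + (angle l - delta)) / 2) with ((angle j + angle l) / 2 - delta) by field.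
  ring.
Qed.

Lemma grid_pred (delta : R) (m : Z) :
  0 < delta < PI / INR p ->
  PI * IZR (m - 1) / INR p < PI * IZR m / INR p - delta < PI * IZR m / INR p.
Proof.
  intro Hd. rewrite minus_IZR.
  replace (PI * (IZR m - 1) / INR p) with (PI * IZR m / INR p - PI / INR p) by (field; lra).
  lra.
Qed.

(** Neither sine of the product formula vanishes: the half difference is not a multiple of [PI] for
    distinct indices, and the half sum minus [delta] lies strictly inside a grid cell. *)
Lemma key_inj (delta : R) (j l : nat) :
  0 < delta < PI / INR p -> (1 <= j <= p)%nat -> (1 <= l <= p)%nat -> j <> l ->
  key delta j <> key delta l.
Proof.
  intros Hd hj hl Hjl H. apply Rminus_diag_eq in H. revert H. rewrite key_diff.
  repeat apply Rmult_integral_contrapositive_currified; try lra; try assumption.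
  - now apply sin_half_diff_neq0.
  - rewrite half_sum_angle.
    apply sin_cell_neq0 with (1 := hp)
      (m := (n - Z.of_nat (p + q) * (Z.of_nat (j - 1) + Z.of_nat (l - 1)))%Z).
    now apply grid_pred.
Qed.

(** In the product formula only the sine of the half sum minus [delta] depends on [delta], and its
    argument stays in one open cell. One ray therefore decides the order on the whole sector. *)
Lemma key_order (delta delta' : R) (j l : nat) :
  0 < delta < PI / INR p -> 0 < delta' < PI / INR p ->
  key delta j < key delta l -> key delta' j < key delta' l.
Proof.
  intros Hd Hd' H.
  assert (H1 : key delta j - key delta l < 0) by lra.
  enough (H2 : key delta' j - key delta' l < 0) by lra.
  rewrite key_diff in *.
  set (c := - 2 * beta * sin ((angle j - angle l) / 2)) in *.
  assert (H3 : 0 < sin ((angle j + angle l) / 2 - delta) * sin ((angle j + angle l) / 2 - delta')).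
  { rewrite half_sum_angle. eapply sin_cell_gt0; [exact hp| |]; now apply grid_pred. }
  nra.
Qed.

(** Equal cosines make one of two sines vanish. Coprimality excludes the half difference, so the
    half sum is a multiple of [PI]. *)
Lemma reflected_cos (j l : nat) :
  (1 <= j <= p)%nat -> (1 <= l <= p)%nat -> j <> l ->
  cos (angle j) = cos (angle l) <-> reflected p q n j l.
Proof.
  intros hj hl Hjl. split.
  - intro H. apply Rminus_diag_eq in H. rewrite form2 in H.
    apply Rmult_integral in H. destruct H as [H|H].
    + exfalso. apply Rmult_integral in H. destruct H as [H|H]; [lra|].
      now apply (sin_half_diff_neq0 j l).
    + apply sin_eq_0_0 in H. destruct H as [d Hd]. exists d.
      rewrite mult_IZR. lra.
  - intros [d Hd]. replace (angle j) with (- angle l + IZR (2 * d) * PI) by lra.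
    now rewrite cos_shift_PI, cos_IZR_2PI, cos_neg, Rmult_1_l.
Qed.

(** Reflection turns [cos (A l - delta)] into [cos (A j + delta)], where [A] is the leading angle;
    the addition formulas leave only the sine product. *)
Lemma key_reflected (delta : R) (j l : nat) :
  reflected p q n j l ->
  key delta l - key delta j = - 2 * (beta * sin (angle j)) * sin delta.
Proof.
  intros [d Hd]. unfold profile_key.
  replace (angle l - delta) with (- (angle j + delta) + IZR (2 * d) * PI) by lra.
  rewrite cos_shift_PI, cos_IZR_2PI, cos_neg, cos_plus, cos_minus. ring.
Qed.

(* With [u], [v] the half sum and half difference of the angles of [k] and [j],
   the product of the two differences is
   [- 4 * beta^2 * (sin u * sin (u - delta)) * (sin v * sin (v - delta))], and
   both factors are nonnegative since [u] and [v] are grid points. *)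
Lemma key_no_between (delta : R) (j l k : nat) :
  0 < delta < PI / INR p -> reflected p q n j l ->
  ~ (key delta j < key delta k /\ key delta k < key delta l).
Proof.
  intros Hd [d Hjl] [H1 H2].
  assert (E1 := key_diff delta k j). assert (E2 := key_diff delta l k).
  replace ((angle l - angle k) / 2) with (- ((angle k + angle j) / 2) + IZR d * PI) in E2
    by (rewrite mult_IZR in Hjl; lra).
  replace ((angle l + angle k) / 2 - delta)
    with (((angle k - angle j) / 2 - delta) + IZR d * PI) in E2
    by (rewrite mult_IZR in Hjl; lra).
  rewrite !sin_shift_PI, sin_neg in E2.
  assert (G : forall m : Z, 0 <= sin (PI * IZR m / INR p) * sin (PI * IZR m / INR p - delta)).
  { intro m. assert (H := grid_pred delta m Hd).
    apply sin_cell_ge0 with (1 := hp) (m := m); lra. }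
  assert (Gu := G (n - Z.of_nat (p + q) * (Z.of_nat (k - 1) + Z.of_nat (j - 1)))%Z).
  rewrite <- half_sum_angle in Gu.
  assert (Gv := G (Z.of_nat (p + q) * (Z.of_nat (j - 1) - Z.of_nat (k - 1)))%Z).
  rewrite <- half_diff_angle in Gv.
  assert (P : 0 < (key delta k - key delta j) * (key delta l - key delta k))
    by (apply Rmult_lt_0_compat; lra).
  rewrite E1, E2 in P.
  set (u := (angle k + angle j) / 2) in *. set (v := (angle k - angle j) / 2) in *.
  replace (- 2 * beta * sin v * sin (u - delta) *
      (- 2 * beta * (cos (IZR d * PI) * - sin u) * (cos (IZR d * PI) * sin (v - delta))))
    with (- 4 * (beta * beta) * (cos (IZR d * PI) * cos (IZR d * PI)) *
      ((sin u * sin (u - delta)) * (sin v * sin (v - delta)))) in P by ring.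
  rewrite cos_IZR_PI_sqr in P.
  assert (0 <= (sin u * sin (u - delta)) * (sin v * sin (v - delta))) by now apply Rmult_le_pos.
  assert (0 <= beta * beta) by nra. nra.
Qed.

Lemma neighbours_neq (j l : nat) : neighbours p q beta n j l -> j <> l.
Proof.
  intros [[d Hd] H] <-.
  replace (angle j) with (IZR d * PI) in H by (rewrite mult_IZR in Hd; lra).
  replace (sin (IZR d * PI)) with 0 in H by (symmetry; apply sin_eq_0_1; now exists d).
  lra.
Qed.

(** If the angle of [j] were [e PI], that of [l] would be [(2 d - e) PI], and their half difference
    [(e - d) PI] would have zero sine. *)
Lemma reflected_sin_neq0 (j l : nat) :
  (1 <= j <= p)%nat -> (1 <= l <= p)%nat -> j <> l ->
  reflected p q n j l -> sin (angle j) <> 0.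
Proof.
  intros hj hl Hjl [d Hd] H. apply sin_eq_0_0 in H. destruct H as [e He].
  apply (sin_half_diff_neq0 j l hj hl Hjl). apply sin_eq_0_1. exists (e - d)%Z.
  rewrite minus_IZR. rewrite mult_IZR in Hd. lra.
Qed.

End Profile.

(** * Asymptotics along rays *)

Definition ray (theta rho : R) : C := (rho * Cexp (Ci * theta))%C.

Lemma Cmod_ray (theta rho : R) : 0 <= rho -> Cmod (ray theta rho) = rho.
Proof.
  intro H. unfold ray. rewrite Cmod_mult, Cmod_R, Cmod_Cexp, Rabs_pos_eq by exact H.
  replace (Re (Ci * theta)) with 0 by (simpl; ring). rewrite exp_0. ring.
Qed.

Lemma ray_infty (theta : R) : filterlim (ray theta) (Rbar_locally p_infty) Cinfty.
Proof.
  intros P [M HM]. exists (Rmax M 0). intros rho Hrho. apply HM.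
  rewrite Cmod_ray.
  - generalize (Rmax_l M 0); lra.
  - generalize (Rmax_r M 0); lra.
Qed.

Lemma is_lim_of_C (g : R -> C) (l : C) :
  filterlim g (Rbar_locally p_infty) (locally l) ->
  is_lim (fun x => Re (g x)) p_infty (Re l) /\
  is_lim (fun x => Im (g x)) p_infty (Im l) /\
  is_lim (fun x => Cmod (g x)) p_infty (Cmod l).
Proof.
  intro H. repeat split.
  - apply (filterlim_comp _ _ _ g Re _ (locally l)); [exact H|].
    destruct l. apply continuous_fst.
  - apply (filterlim_comp _ _ _ g Im _ (locally l)); [exact H|].
    destruct l. apply continuous_snd.
  - apply (filterlim_comp _ _ _ g Cmod _ (locally l)); [exact H|].
    apply (filterlim_norm (V := C_NormedModule) l).
Qed.

Lemma is_lim_mult_R (f g : R -> R) (x : Rbar) (a b : R) :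
  is_lim f x a -> is_lim g x b -> is_lim (fun y => f y * g y) x (a * b).
Proof. intros Hf Hg. exact (is_lim_mult f g x a b Hf Hg I). Qed.

Lemma eventually_pos : Rbar_locally' p_infty (fun x : R => 0 < x).
Proof. now exists 0. Qed.

Section Ray.

Variables (p : nat) (mu : R) (tau : C -> C) (theta : R).
Hypothesis htau : is_tau p mu tau.

Let t (rho : R) : R := Re (tau (ray theta rho)).
Let y (rho : R) : R := Im (tau (ray theta rho)).
Let M : R := Rpower mu (- / (2 * INR p)).
(** The normalizing ratio of [is_tau] on the ray, which tends to 1. Its modulus gives the growth of
    [exp (t rho)], and [y rho - theta] is an argument of it. *)
Let g (rho : R) : C := (Cexp (tau (ray theta rho)) / (2 * ray theta rho * M))%C.

Let M_pos : 0 < M.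
Proof. apply exp_pos. Qed.

Let g_eq (rho : R) :
  0 < rho -> g rho = ((/ (2 * rho * M))%R * Cexp (tau (ray theta rho) - Ci * theta))%C.
Proof.
  intro H. unfold g, ray. replace (tau (rho * Cexp (Ci * theta)) - Ci * theta)%C
    with (tau (rho * Cexp (Ci * theta)) + - (Ci * theta))%C by ring.
  rewrite Cexp_plus, Cexp_opp.
  assert (2 * rho * M <> 0) by (apply Rgt_not_eq; repeat apply Rmult_lt_0_compat; lra).
  rewrite RtoC_inv, !RtoC_mult by assumption. field.
  repeat split; try apply Cexp_neq_0; apply RtoC_neq_0; lra.
Qed.

Let g_lim : filterlim g (Rbar_locally p_infty) (locally (RtoC 1)).
Proof.
  destruct htau as [_ H].
  exact (filterlim_comp _ _ _ (ray theta) _ _ _ _ (ray_infty theta) H).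
Qed.

Let Cmod_g (rho : R) : 0 < rho -> Cmod (g rho) = / (2 * rho * M) * exp (t rho).
Proof.
  intro H. rewrite g_eq, Cmod_mult, Cmod_R, Cmod_Cexp by exact H.
  assert (0 < 2 * rho * M) by (repeat apply Rmult_lt_0_compat; lra).
  rewrite Rabs_pos_eq by (left; now apply Rinv_0_lt_compat).
  unfold t. do 2 f_equal. destruct (tau (ray theta rho)). simpl. ring.
Qed.

Let Re_g (rho : R) : 0 < rho ->
  Re (g rho) = / (2 * rho * M) * (exp (t rho) * cos (y rho - theta)).
Proof.
  intro H. rewrite g_eq, Re_scale, Re_Cexp by exact H.
  unfold t, y. do 3 f_equal; destruct (tau (ray theta rho)); simpl; ring.
Qed.

Let Im_g (rho : R) : 0 < rho ->
  Im (g rho) = / (2 * rho * M) * (exp (t rho) * sin (y rho - theta)).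
Proof.
  intro H. rewrite g_eq, Im_scale, Im_Cexp by exact H.
  unfold t, y. do 3 f_equal; destruct (tau (ray theta rho)); simpl; ring.
Qed.

Let Cmod_inv_lim : is_lim (fun rho => / Cmod (g rho)) p_infty 1.
Proof.
  replace (Finite 1) with (Rbar_inv (Cmod (RtoC 1))).
  - apply is_lim_inv; [apply (is_lim_of_C _ _ g_lim)|].
    rewrite Cmod_1. intro E. injection E; lra.
  - rewrite Cmod_1. simpl. now rewrite Rinv_1.
Qed.

(** Dividing [g] by its modulus removes the growth and leaves the unit number of argument
    [y rho - theta]. *)
Lemma ray_cos : is_lim (fun rho => cos (y rho - theta)) p_infty 1.
Proof.
  apply (is_lim_ext_loc (fun rho => Re (g rho) * / Cmod (g rho))).
  - eapply filter_imp; [|exact eventually_pos]. cbv beta. intros rho H.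
    rewrite Re_g, Cmod_g by exact H. field.
    repeat split; try lra. apply Rgt_not_eq, exp_pos.
  - replace (Finite 1) with (Finite (1 * 1)) by (f_equal; ring).
    apply is_lim_mult_R; [|exact Cmod_inv_lim].
    apply (is_lim_of_C _ _ g_lim).
Qed.

Lemma ray_sin : is_lim (fun rho => sin (y rho - theta)) p_infty 0.
Proof.
  apply (is_lim_ext_loc (fun rho => Im (g rho) * / Cmod (g rho))).
  - eapply filter_imp; [|exact eventually_pos]. cbv beta. intros rho H.
    rewrite Im_g, Cmod_g by exact H. field.
    repeat split; try lra. apply Rgt_not_eq, exp_pos.
  - replace (Finite 0) with (Finite (0 * 1)) by (f_equal; ring).
    apply is_lim_mult_R; [|exact Cmod_inv_lim].
    apply (is_lim_of_C _ _ g_lim).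
Qed.

(** Since [Cmod (g rho)] is [exp (t rho) / (2 rho M)] and tends to 1, [exp (- t rho)] decays like
    [1 / (2 M rho)]. *)
Lemma ray_exp : is_lim (fun rho => exp (- t rho)) p_infty 0.
Proof.
  apply (is_lim_ext_loc (fun rho => / Cmod (g rho) * (/ (2 * M) * / rho))).
  - eapply filter_imp; [|exact eventually_pos]. cbv beta. intros rho H.
    rewrite Cmod_g, exp_Ropp by exact H. field.
    repeat split; try lra. apply Rgt_not_eq, exp_pos.
  - replace (Finite 0) with (Finite (1 * (/ (2 * M) * 0))) by (f_equal; ring).
    apply is_lim_mult_R; [exact Cmod_inv_lim|].
    apply is_lim_mult_R; [apply is_lim_const|].
    exact (is_lim_inv (fun x => x) p_infty p_infty (is_lim_id p_infty) ltac:(discriminate)).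
Qed.

(** The angle [y rho] is controlled only modulo [2 PI], so limits are taken of the cosine and sine
    of integer multiples, by the addition formulas, and not of [y rho] itself. *)
Let ray_cos_sin_mult (n : nat) :
  is_lim (fun rho => cos (INR n * (y rho - theta))) p_infty 1 /\
  is_lim (fun rho => sin (INR n * (y rho - theta))) p_infty 0.
Proof.
  induction n as [|n [IHc IHs]].
  - split.
    + apply (is_lim_ext (fun _ => 1)); [|apply is_lim_const].
      intro. simpl. now rewrite Rmult_0_l, cos_0.
    + apply (is_lim_ext (fun _ => 0)); [|apply is_lim_const].
      intro. simpl. now rewrite Rmult_0_l, sin_0.
  - split.
    + apply (is_lim_ext (fun rho => cos (INR n * (y rho - theta)) * cos (y rho - theta)
        + - 1 * (sin (INR n * (y rho - theta)) * sin (y rho - theta)))).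
      * intro. rewrite S_INR, Rmult_plus_distr_r, Rmult_1_l, cos_plus. ring.
      * replace (Finite 1) with (Finite (1 * 1 + - 1 * (0 * 0))) by (f_equal; ring).
        apply is_lim_plus'; repeat apply is_lim_mult_R;
          first [apply is_lim_const | assumption | apply ray_cos | apply ray_sin].
    + apply (is_lim_ext (fun rho => sin (INR n * (y rho - theta)) * cos (y rho - theta)
        + cos (INR n * (y rho - theta)) * sin (y rho - theta))).
      * intro. rewrite S_INR, Rmult_plus_distr_r, Rmult_1_l, sin_plus. ring.
      * replace (Finite 0) with (Finite (0 * 1 + 1 * 0)) by (f_equal; ring).
        apply is_lim_plus'; repeat apply is_lim_mult_R;
          first [apply is_lim_const | assumption | apply ray_cos | apply ray_sin].
Qed.

Lemma ray_cos_mult (n : nat) (c : R) :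
  is_lim (fun rho => cos (INR n * (y rho - c))) p_infty (cos (INR n * (theta - c))).
Proof.
  destruct (ray_cos_sin_mult n) as [Hc Hs].
  apply (is_lim_ext (fun rho => cos (INR n * (y rho - theta)) * cos (INR n * (theta - c))
     + sin (INR n * (y rho - theta)) * (- sin (INR n * (theta - c))))).
  - intro rho. replace (INR n * (y rho - c))
      with (INR n * (y rho - theta) + INR n * (theta - c)) by ring.
    rewrite cos_plus. ring.
  - replace (Finite (cos (INR n * (theta - c))))
      with (Finite (1 * cos (INR n * (theta - c)) + 0 * (- sin (INR n * (theta - c)))))
      by (f_equal; ring).
    apply is_lim_plus'; apply is_lim_mult_R; try apply is_lim_const; assumption.
Qed.

Lemma ray_exp_mult (n : nat) (hn : (1 <= n)%nat) :
  is_lim (fun rho => exp (- (INR n * t rho))) p_infty 0.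
Proof.
  induction n as [|[|n] IH]; [lia | |].
  - apply (is_lim_ext (fun rho => exp (- t rho))); [|apply ray_exp].
    intro. simpl. now rewrite Rmult_1_l.
  - apply (is_lim_ext (fun rho => exp (- (INR (S n) * t rho)) * exp (- t rho))).
    + intro. rewrite <- exp_plus. f_equal. rewrite (S_INR (S n)). ring.
    + replace (Finite 0) with (Finite (0 * 0)) by (f_equal; ring).
      apply is_lim_mult_R; [apply IH; lia | apply ray_exp].
Qed.

End Ray.

Lemma is_lim_mult_bounded (f h : R -> R) :
  is_lim f p_infty 0 -> (forall x, Rabs (h x) <= 1) ->
  is_lim (fun x => f x * h x) p_infty 0.
Proof.
  intros Hf Hh.
  assert (Ha : is_lim (fun x => Rabs (f x)) p_infty 0).
  { generalize (is_lim_Rabs _ _ _ Hf). simpl. now rewrite Rabs_R0. }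
  apply (is_lim_le_le_loc (fun x => - Rabs (f x)) (fun x => Rabs (f x))).
  - exists 0. intros x _. specialize (Hh x).
    assert (H : Rabs (f x * h x) <= Rabs (f x)).
    { rewrite Rabs_mult. generalize (Rabs_pos (f x)). nra. }
    now apply Rabs_le_between.
  - generalize (is_lim_opp _ _ _ Ha). simpl. now rewrite Ropp_0.
  - exact Ha.
Qed.

Lemma Rabs_cos_le (x : R) : Rabs (cos x) <= 1.
Proof. apply Rabs_le. generalize (COS_bound x). lra. Qed.

(** The factor [2 exp (- r t)] normalizes the dominant [cosh (r t)], whose cosine converges on the
    ray; everything else is a decaying exponential times a bounded cosine. *)
Lemma phi_ray_lim (p q : nat) (beta mu : R) (tau : C -> C) (theta : R) (j : nat) :
  (1 <= p)%nat -> (1 <= q)%nat -> p <> q -> is_tau p mu tau ->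
  is_lim (fun rho => 2 * exp (- (INR (p + q) * Re (tau (ray theta rho)))) *
            Re (phi p q beta mu j (tau (ray theta rho))))
    p_infty (phi_coeff p q beta mu * (cos (INR (p + q) * (theta - shift p j)) / INR (p + q))).
Proof.
  intros hp hq hpq htau.
  assert (0 < INR p) by (apply lt_0_INR; lia).
  assert (0 < INR q) by (apply lt_0_INR; lia).
  assert (INR q <> INR p) by (intro E; apply INR_eq in E; lia).
  set (t rho := Re (tau (ray theta rho))). set (y rho := Im (tau (ray theta rho))).
  set (r := (p + q)%nat) in *.
  assert (Er : INR r = INR p + INR q) by apply plus_INR.
  (* The second hyperbolic cosine has exponents [q - p] and [p - q]; subtracting [r] gives [- 2 p]
     and [- 2 q]. Both decay whichever of [p] and [q] is larger. *)
  apply (is_lim_ext (fun rho => phi_coeff p q beta mu *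
     (cos (INR r * (y rho - shift p j)) * / INR r
      + (exp (- (INR (2 * r) * t rho)) * cos (INR r * (y rho - shift p j)) * / INR r
      + (exp (- (INR (2 * p) * t rho)) + exp (- (INR (2 * q) * t rho))) *
           cos ((INR q - INR p) * (y rho - shift p j)) * - / (INR q - INR p))))).
  - intro rho. rewrite Re_phi by assumption. fold (t rho) (y rho). unfold cosh.
    rewrite <- Er, !mult_INR.
    replace (INR 2) with 2 by reflexivity.
    replace (exp (- (2 * INR r * t rho))) with (exp (- (INR r * t rho)) * exp (- (INR r * t rho)))
      by (rewrite <- exp_plus; f_equal; ring).
    replace (exp (- (2 * INR p * t rho)))
      with (exp (- (INR r * t rho)) * exp ((INR q - INR p) * t rho))
      by (rewrite <- exp_plus; f_equal; rewrite Er; ring).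
    replace (exp (- (2 * INR q * t rho)))
      with (exp (- (INR r * t rho)) * exp (- ((INR q - INR p) * t rho)))
      by (rewrite <- exp_plus; f_equal; rewrite Er; ring).
    replace (exp (INR r * t rho)) with (/ exp (- (INR r * t rho)))
      by (rewrite <- exp_Ropp; f_equal; ring).
    field. repeat split; try lra. apply Rgt_not_eq, exp_pos.
  - replace (cos (INR r * (theta - shift p j)) / INR r)
      with (cos (INR r * (theta - shift p j)) * / INR r
            + (0 * / INR r + 0 * - / (INR q - INR p))) by (unfold Rdiv; ring).
    apply is_lim_mult_R; [apply is_lim_const|].
    apply is_lim_plus'; [|apply is_lim_plus'];
      (apply is_lim_mult_R; [|apply is_lim_const]).
    + now apply (ray_cos_mult p mu).
    + apply is_lim_mult_bounded; [|intro; apply Rabs_cos_le].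
      apply (ray_exp_mult p mu); [exact htau | lia].
    + apply is_lim_mult_bounded; [|intro; apply Rabs_cos_le].
      replace (Finite 0) with (Finite (0 + 0)) by (f_equal; ring).
      apply is_lim_plus'; apply (ray_exp_mult p mu); first [exact htau | lia].
Qed.

(** * Existence of the uniformizing variable *)

Lemma filterlim_Cmod {T : Type} (F : (T -> Prop) -> Prop) {FF : Filter F} (f : T -> C) (l : C) :
  filterlim f F (locally l) <->
  (forall eps : R, 0 < eps -> F (fun x => Cmod (f x - l) < eps)).
Proof.
  rewrite (filterlim_locally_ball_norm (K := C_AbsRing) (U := C_NormedModule) f l).
  split.
  - intros H eps Heps. exact (H (mkposreal eps Heps)).
  - intros H eps. exact (H eps (cond_pos eps)).
Qed.

Lemma locally_Cmod (z : C) (P : C -> Prop) (delta : R) :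
  0 < delta -> (forall y : C, Cmod (y - z) < delta -> P y) -> locally z P.
Proof.
  intros Hd H. apply (locally_le_locally_norm (K := C_AbsRing) (V := C_NormedModule)).
  now exists (mkposreal delta Hd).
Qed.

#[local] Instance Cinfty_filter : Filter Cinfty.
Proof.
  constructor.
  - now exists 0.
  - intros P Q [M HM] [N HN]. exists (Rmax M N). intros z Hz. split.
    + apply HM. generalize (Rmax_l M N); lra.
    + apply HN. generalize (Rmax_r M N); lra.
  - intros P Q H [M HM]. exists M. auto.
Qed.

Lemma filterlim_affine (a b z : C) :
  filterlim (fun x => a * x + b)%C (locally z) (locally (a * z + b)%C).
Proof.
  apply filterlim_Cmod; [apply locally_filter|]. intros eps Heps.
  assert (Ha := Cmod_ge_0 a).
  apply locally_Cmod with (eps / (Cmod a + 1)); [apply Rdiv_lt_0_compat; lra|].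
  intros y Hy. replace (a * y + b - (a * z + b))%C with (a * (y - z))%C by ring.
  rewrite Cmod_mult. assert (Hyz := Cmod_ge_0 (y - z)).
  apply Rle_lt_trans with ((Cmod a + 1) * Cmod (y - z)); [nra|].
  replace eps with ((Cmod a + 1) * (eps / (Cmod a + 1))) by (field; lra).
  apply Rmult_lt_compat_l; lra.
Qed.

Lemma filterlim_Cexp_0 : filterlim Cexp (locally (RtoC 0)) (locally (RtoC 1)).
Proof.
  apply filterlim_Cmod; [apply locally_filter|]. intros eps Heps.
  destruct (Cexp_remainder 1) as [d [Hd H]]; [lra|].
  apply locally_Cmod with (Rmin d (eps / 2)); [apply Rmin_glb_lt; lra|].
  intros y Hy. replace (y - 0)%C with y in Hy by ring.
  assert (Cmod y < d) by (eapply Rlt_le_trans; [exact Hy | apply Rmin_l]).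
  assert (Cmod y < eps / 2) by (eapply Rlt_le_trans; [exact Hy | apply Rmin_r]).
  replace (Cexp y - 1)%C with ((Cexp y - 1 - y) + y)%C by ring.
  eapply Rle_lt_trans; [apply Cmod_triangle|].
  specialize (H y ltac:(assumption)). lra.
Qed.

(** The sign of the imaginary part selects the half plane, since [acos] sees only the real part. The
    branch is the principal one, continuous at 1. *)
Definition Clog (z : C) : C :=
  (ln (Cmod z),
   if Rle_dec 0 (Im z) then acos (Re z / Cmod z) else - acos (Re z / Cmod z)).

Lemma Cexp_Clog (z : C) : z <> 0 -> Cexp (Clog z) = z.
Proof.
  intro Hz. assert (Hm : 0 < Cmod z) by now apply Cmod_gt_0.
  assert (Hc : -1 <= Re z / Cmod z <= 1).
  { apply Rabs_le_between. rewrite Rabs_div, (Rabs_pos_eq (Cmod z)) by lra.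
    apply Rmult_le_reg_r with (Cmod z); [exact Hm|].
    replace (Rabs (Re z) / Cmod z * Cmod z) with (Rabs (Re z)) by (field; lra).
    rewrite Rmult_1_l. apply re_le_Cmod. }
  assert (Hs : sqrt (1 - (Re z / Cmod z)²) = Rabs (Im z) / Cmod z).
  { rewrite <- (Rabs_pos_eq (Cmod z)) at 2 by lra. rewrite <- Rabs_div by lra.
    rewrite <- sqrt_Rsqr_abs. f_equal.
    assert (E : Cmod z * Cmod z = Re z * Re z + Im z * Im z).
    { unfold Cmod. rewrite sqrt_sqrt by nra. unfold Re, Im. ring. }
    unfold Rsqr. apply Rmult_eq_reg_r with (Cmod z * Cmod z); [|nra].
    replace ((1 - Re z / Cmod z * (Re z / Cmod z)) * (Cmod z * Cmod z))
      with (Cmod z * Cmod z - Re z * Re z) by (field; lra).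
    rewrite E at 1. field. lra. }
  apply C_ext; rewrite ?Re_Cexp, ?Im_Cexp; unfold Clog; simpl Re; simpl Im;
    rewrite exp_ln by exact Hm; destruct (Rle_dec 0 (Im z)) as [Hi|Hi].
  - rewrite cos_acos by exact Hc. field. lra.
  - rewrite cos_neg, cos_acos by exact Hc. field. lra.
  - rewrite sin_acos by exact Hc. rewrite Hs, Rabs_pos_eq by exact Hi. field. lra.
  - rewrite sin_neg, sin_acos by exact Hc. rewrite Hs, Rabs_left by lra. field. lra.
Qed.

(** The slope of [acos] is infinite at 1, so continuity is read off the expression by [atan], valid
    for positive arguments. *)
Lemma acos_lim_1 : filterlim acos (locally 1) (locally 0).
Proof.
  apply (filterlim_ext_loc (fun x => atan (sqrt (1 - x²) * / x))).
  - exists (mkposreal (1 / 2) ltac:(lra)). intros x Hx. symmetry. apply acos_atan.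
    change (Rabs (x - 1) < 1 / 2) in Hx. apply Rabs_lt_between in Hx. lra.
  - replace 0 with (atan (sqrt (1 - 1²) * / 1)).
    + apply (continuous_atan_comp (fun x => sqrt (1 - x²) * / x)).
      apply (continuous_mult (fun x : R_UniformSpace => sqrt (1 - x²)) Rinv).
      * apply (continuous_comp (fun x : R => 1 - x²) sqrt).
        -- apply (ex_derive_continuous (fun x : R => 1 - x²)). unfold Rsqr. now auto_derive.
        -- apply continuity_pt_filterlim, continuity_pt_sqrt. unfold Rsqr. lra.
      * apply (ex_derive_continuous Rinv). auto_derive. lra.
    + replace (1 - 1²) with 0 by (unfold Rsqr; ring).
      now rewrite sqrt_0, Rmult_0_l, atan_0.
Qed.

Lemma filterlim_Clog_1 : filterlim Clog (locally (RtoC 1)) (locally (RtoC 0)).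
Proof.
  assert (Hm : filterlim Cmod (locally (RtoC 1)) (locally 1)).
  { assert (H := filterlim_norm (V := C_NormedModule) (RtoC 1)).
    change (norm (RtoC 1)) with (Cmod (RtoC 1)) in H. now rewrite Cmod_1 in H. }
  assert (Hln : filterlim (fun z => ln (Cmod z)) (locally (RtoC 1)) (locally 0)).
  { eapply filterlim_comp; [exact Hm|].
    assert (H := continuous_ln 1 Rlt_0_1). unfold continuous in H. now rewrite ln_1 in H. }
  assert (Hac : filterlim (fun z : C => acos (Re z / Cmod z)) (locally (RtoC 1)) (locally 0)).
  { eapply filterlim_comp; [|exact acos_lim_1].
    replace (locally (T := R_UniformSpace) 1) with (locally (T := R_UniformSpace) (1 * / 1))
      by (f_equal; field).
    apply (filterlim_comp_2 (G := locally 1) (H := locally (/ 1)) Re (fun z => / Cmod z) Rmult).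
    - exact (continuous_fst 1 0).
    - apply (filterlim_comp _ _ _ Cmod Rinv _ (locally 1)); [exact Hm|].
      apply (ex_derive_continuous Rinv). auto_derive. lra.
    - apply (filterlim_mult (K := R_AbsRing) 1 (/ 1)). }
  apply filterlim_Cmod; [apply locally_filter|]. intros eps Heps.
  assert (He : 0 < eps / 2) by lra.
  generalize (filter_and _ _
    (proj1 (filterlim_locally _ _) Hln (mkposreal _ He))
    (proj1 (filterlim_locally _ _) Hac (mkposreal _ He))).
  apply filter_imp. intros z [H1 H2].
  change (Rabs (ln (Cmod z) - 0) < eps / 2) in H1.
  change (Rabs (acos (Re z / Cmod z) - 0) < eps / 2) in H2.
  rewrite Rminus_0_r in H1, H2.
  eapply Rle_lt_trans; [apply Cmod_le_Rabs|].
  replace (Re (Clog z - 0)) with (ln (Cmod z)) by (unfold Clog; simpl; ring).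
  (* The choice of half plane changes only the sign of the imaginary part, so it disappears in the
     absolute value. *)
  replace (Rabs (Im (Clog z - 0))) with (Rabs (acos (Re z / Cmod z))); [lra|].
  unfold Clog. simpl. rewrite Ropp_0, Rplus_0_r.
  destruct (Rle_dec 0 (Im z)); [reflexivity | now rewrite Rabs_Ropp].
Qed.

(* The root near [1] of [w * (1 - w) = e]. With [e = u^(-2p)], the ansatz
   [exp (p * tau) = u^p * w] turns [2 * cosh (p * tau) = u^p] into this equation. *)
Definition quad_root (e : C) : C := ((1 + Cexp (/ 2 * Clog (1 - 4 * e))) / 2)%C.

(** This is the quadratic formula: halving the logarithm gives a square root of the discriminant
    [1 - 4 e], which must be nonzero for [Clog] to invert [Cexp]. *)
Lemma quad_root_eq (e : C) :
  (1 - 4 * e)%C <> 0 -> (quad_root e * (1 - quad_root e))%C = e.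
Proof.
  intro He. unfold quad_root. set (s := Cexp (/ 2 * Clog (1 - 4 * e))).
  assert (Hs : (s * s)%C = (1 - 4 * e)%C).
  { unfold s. rewrite <- Cexp_plus.
    replace (/ 2 * Clog (1 - 4 * e) + / 2 * Clog (1 - 4 * e))%C
      with (Clog (1 - 4 * e)) by field.
    now apply Cexp_Clog. }
  replace ((1 + s) / 2 * (1 - (1 + s) / 2))%C with ((1 - s * s) / 4)%C
    by field.
  rewrite Hs. field.
Qed.

Lemma filterlim_quad_root : filterlim quad_root (locally (RtoC 0)) (locally (RtoC 1)).
Proof.
  assert (H1 := filterlim_affine (- 4) 1 0). replace (- 4 * 0 + 1)%C with (RtoC 1) in H1 by ring.
  assert (H2 := filterlim_affine (/ 2) 0 0). replace (/ 2 * 0 + 0)%C with (RtoC 0) in H2 by ring.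
  assert (H3 := filterlim_affine (/ 2) (/ 2) 1).
  replace (/ 2 * 1 + / 2)%C with (RtoC 1) in H3 by field.
  eapply filterlim_ext;
    [|exact (filterlim_comp _ _ _ _ _ _ _ _
        (filterlim_comp _ _ _ _ _ _ _ _
          (filterlim_comp _ _ _ _ _ _ _ _
            (filterlim_comp _ _ _ _ _ _ _ _ H1 filterlim_Clog_1) H2)
          filterlim_Cexp_0) H3)].
  intro e. unfold quad_root. cbv beta.
  replace (- 4 * e + 1)%C with (1 - 4 * e)%C by ring.
  replace (/ 2 * Clog (1 - 4 * e) + 0)%C with (/ 2 * Clog (1 - 4 * e))%C by ring.
  field.
Qed.

Section Tau.

Variables (p : nat) (mu : R).
Hypothesis hp : (1 <= p)%nat.
Hypothesis hmu : 0 < mu.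

Let M : R := Rpower mu (- / (2 * INR p)).
Let u (lambda : C) : C := (2 * lambda * M)%C.
Let e (lambda : C) : C := (/ (u lambda ^ p * u lambda ^ p))%C.
Let corr (lambda : C) : C := (/ INR p * Clog (quad_root (e lambda)))%C.

(** [Clog (u lambda)] alone has the prescribed leading behaviour. The correction, tending to 0,
    multiplies the exponential by a [p]-th root of [quad_root] and makes the equation exact. *)
Definition tau_inf (lambda : C) : C := (Clog (u lambda) + corr lambda)%C.

Let M_pos : 0 < M.
Proof. apply exp_pos. Qed.

Let INRp_pos : 0 < INR p.
Proof. apply lt_0_INR; lia. Qed.

(** This turns the equation between [lambda] and [tau] into [u^p = 2 cosh (p tau)]. *)
Let sqrt_mu_M : sqrt mu * M ^ p = 1.
Proof.
  rewrite <- Rpower_sqrt by exact hmu. unfold M.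
  rewrite <- Rpower_pow by apply exp_pos.
  rewrite Rpower_mult, <- Rpower_plus.
  replace (/ 2 + - / (2 * INR p) * INR p) with 0 by (field; lra).
  now apply Rpower_O.
Qed.

Let u_large (K : R) : Cinfty (fun lambda => K < Cmod (u lambda)).
Proof.
  exists (K / (2 * M)). intros z Hz. unfold u.
  rewrite !Cmod_mult, !Cmod_R, !Rabs_pos_eq by lra.
  replace K with (K / (2 * M) * (2 * M)) by (field; lra).
  replace (2 * Cmod z * M) with (Cmod z * (2 * M)) by ring.
  apply Rmult_lt_compat_r; lra.
Qed.

Let e_lim : filterlim e Cinfty (locally (RtoC 0)).
Proof.
  apply filterlim_Cmod; [apply Cinfty_filter|]. intros eps Heps.
  generalize (filter_and _ _ (u_large 1) (u_large (/ eps))).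
  apply filter_imp. intros z [H1 H2].
  assert (Hu : u z <> 0) by (intro E; rewrite E, Cmod_0 in H1; lra).
  replace (e z - 0)%C with (e z) by ring. unfold e.
  rewrite Cmod_inv by (apply Cmult_neq_0; now apply Cpow_nz).
  rewrite Cmod_mult, Cmod_pow.
  assert (Hpow : Cmod (u z) ^ 1 <= Cmod (u z) ^ p) by (apply Rle_pow; [lra | lia]).
  rewrite pow_1 in Hpow. rewrite <- (Rinv_inv eps).
  apply Rinv_lt_contravar; [|nra].
  apply Rmult_lt_0_compat; [now apply Rinv_0_lt_compat | nra].
Qed.

Let corr_lim : filterlim corr Cinfty (locally (RtoC 0)).
Proof.
  assert (H := filterlim_affine (/ INR p) 0 0).
  replace (/ INR p * 0 + 0)%C with (RtoC 0) in H by ring.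
  eapply filterlim_ext;
    [|exact (filterlim_comp _ _ _ _ _ _ _ _ e_lim
        (filterlim_comp _ _ _ _ _ _ _ _ filterlim_quad_root
          (filterlim_comp _ _ _ _ _ _ _ _ filterlim_Clog_1 H)))].
  intro z. unfold corr. cbv beta. ring.
Qed.

Lemma tau_inf_is_tau : is_tau p mu tau_inf.
Proof.
  assert (Hp : RtoC (INR p) <> 0) by (apply RtoC_neq_0; lra).
  split.
  - assert (Hs : Cinfty (fun z => Cmod (corr z - 0) < 1)).
    { apply (proj1 (filterlim_Cmod _ _ _) corr_lim). lra. }
    assert (He : Cinfty (fun z => Cmod (e z - 0) < / 4)).
    { apply (proj1 (filterlim_Cmod _ _ _) e_lim). lra. }
    (* With [|u| > exp 1] the logarithm exceeds 1 and outweighs the correction, so the real part is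
       positive; [|e| < 1/4] keeps the discriminant nonzero. *)
    generalize (filter_and _ _ (u_large (exp 1)) (filter_and _ _ Hs He)).
    apply filter_imp. clear Hs He. intros z [Hu [Hc He]].
    assert (Hexp := exp_pos 1).
    assert (Hu0 : u z <> 0) by (intro E; rewrite E, Cmod_0 in Hu; lra).
    replace (e z - 0)%C with (e z) in He by ring.
    replace (corr z - 0)%C with (corr z) in Hc by ring.
    assert (He4 : (1 - 4 * e z)%C <> 0).
    { intro E. assert (E' : e z = (/ 4)%R).
      { rewrite RtoC_inv by lra. replace (e z) with ((1 - (1 - 4 * e z)) / 4)%C
          by field. rewrite E. field. }
      rewrite E', Cmod_R, Rabs_pos_eq in He by lra. lra. }
    assert (Hup : (u z ^ p)%C <> 0) by now apply Cpow_nz.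
    assert (Hq := quad_root_eq (e z) He4).
    set (w := quad_root (e z)) in *.
    assert (Hquad : (u z ^ p * u z ^ p * (w * (1 - w)))%C = 1).
    { rewrite Hq. unfold e. field. exact Hup. }
    assert (Hw : w <> 0).
    { intro E. rewrite E in Hquad. revert Hquad.
      replace (u z ^ p * u z ^ p * (0 * (1 - 0)))%C with (RtoC 0) by ring.
      intro E'. apply RtoC_inj in E'. lra. }
    split.
    + assert (Hcosh : Cexp (INR p * tau_inf z) = (u z ^ p * w)%C).
      { unfold tau_inf, corr. fold w.
        replace (INR p * (Clog (u z) + / INR p * Clog w))%C
          with (INR p * Clog (u z) + Clog w)%C by (field; exact Hp).
        rewrite Cexp_plus, <- Cexp_pow, !Cexp_Clog by assumption. reflexivity. }
      unfold Ccosh. rewrite Cexp_opp, Hcosh.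
      (* The equation [w (1 - w) = u^(-2p)] says that [u^p w] and [u^p (1 - w)] are inverse to each
         other, and their half sum is [u^p / 2]. *)
      replace (/ (u z ^ p * w))%C with (u z ^ p * (1 - w))%C.
      * replace ((u z ^ p * w + u z ^ p * (1 - w)) / 2)%C with (u z ^ p / 2)%C
          by field.
        unfold u. rewrite !Cpow_mult_l.
        replace (2 * sqrt mu * (2 ^ p * z ^ p * M ^ p / 2))%C
          with (2 ^ p * z ^ p * (sqrt mu * M ^ p))%C by field.
        rewrite <- (RtoC_pow M), <- RtoC_mult, sqrt_mu_M. ring.
      * replace (u z ^ p * (1 - w))%C
          with (u z ^ p * u z ^ p * (w * (1 - w)) * / (u z ^ p * w))%C
          by (field; split; assumption).
        rewrite Hquad. ring.
    + unfold tau_inf. change (Re (Clog (u z) + corr z)) with (ln (Cmod (u z)) + Re (corr z)).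
      assert (H1 : 1 < ln (Cmod (u z))).
      { rewrite <- (ln_exp 1). now apply ln_increasing. }
      assert (H2 := re_le_Cmod (corr z)). apply Rabs_le_between in H2. lra.
  - eapply filterlim_ext_loc;
      [|exact (filterlim_comp _ _ _ _ _ _ _ _ corr_lim filterlim_Cexp_0)].
    generalize (u_large 0). apply filter_imp. intros z Hz.
    assert (Hu0 : u z <> 0) by (intro E; rewrite E, Cmod_0 in Hz; lra).
    unfold tau_inf. rewrite Cexp_plus, Cexp_Clog by exact Hu0.
    fold M. fold (u z). field. exact Hu0.
Qed.

End Tau.

(** * Profiles and critical points *)

Lemma eventually_lt (f g : R -> R) (a b : R) :
  is_lim f p_infty a -> is_lim g p_infty b -> a < b ->
  Rbar_locally p_infty (fun x => f x < g x).
Proof.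
  intros Hf Hg Hab.
  assert (H : is_lim (fun x => g x - f x) p_infty (b - a)) by now apply is_lim_minus'.
  eapply filter_imp; [|apply (H (fun z => 0 < z)), (open_gt 0); lra].
  cbv beta. intros; lra.
Qed.

(** Sortedness of a finite list is a finite conjunction of comparisons of adjacent entries, hence
    eventual if each of them is. *)
Lemma eventually_Sorted {A : Type} (lt : A -> A -> Prop) (Q : R -> A -> A -> Prop) (J : list A) :
  Sorted lt J ->
  (forall x y, In x J -> In y J -> lt x y -> Rbar_locally p_infty (fun rho => Q rho x y)) ->
  Rbar_locally p_infty (fun rho => Sorted (Q rho) J).
Proof.
  induction J as [|x J IH]; intros Hs HQ.
  - apply filter_forall. constructor.
  - apply Sorted_inv in Hs. destruct Hs as [Hs Hx].
    assert (H1 : Rbar_locally p_infty (fun rho => Sorted (Q rho) J)).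
    { apply IH; [exact Hs|]. intros y z Hy Hz Hyz. apply HQ; [now right | now right | exact Hyz]. }
    destruct J as [|y J].
    + apply filter_forall. repeat constructor.
    + apply HdRel_inv in Hx.
      generalize (filter_and _ _ H1 (HQ x y (or_introl eq_refl) (or_intror (or_introl eq_refl)) Hx)).
      apply filter_imp. intros rho [H2 H3]. constructor; [exact H2 | now constructor].
Qed.

(** * Parentheses as neighbouring leading terms *)

Section Main.

Variables (p q : nat) (beta mu : R).
Hypothesis hp : (1 <= p)%nat.
Hypothesis hq : (1 <= q)%nat.
Hypothesis hpq : Nat.gcd p q = 1%nat.
Hypothesis hneq : p <> q.
Hypothesis hbeta : beta <> 0.

Let INRp_pos : 0 < INR p.
Proof. apply lt_0_INR; lia. Qed.

Let INRq_pos : 0 < INR q.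
Proof. apply lt_0_INR; lia. Qed.

Let INRr : INR (p + q) = INR p + INR q.
Proof. apply plus_INR. Qed.

Lemma omega_exp_Cexp (n : Z) (j : nat) :
  (omega_exp p q j * Cexp (Ci * INR (p + q) * chi p q n))%C = Cexp (Ci * lead_angle p q n j).
Proof.
  unfold omega_exp, omega. rewrite Cexp_pow, <- Cexp_opp, <- Cexp_plus. f_equal.
  unfold lead_angle, chi.
  rewrite minus_IZR, !mult_IZR, <- !INR_IZR_INZ, mult_INR.
  assert (RtoC (INR p) <> 0) by (apply RtoC_neq_0; lra).
  assert (RtoC (INR (p + q)) <> 0) by (apply RtoC_neq_0; lra).
  assert (INR p * INR (p + q) <> 0) by (apply Rgt_not_eq, Rmult_lt_0_compat; lra).
  rewrite !RtoC_div by lra. rewrite !RtoC_mult, RtoC_minus, !RtoC_mult.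
  field. now split.
Qed.

Lemma stokes_line_cos (n : Z) (j l : nat) :
  stokes_line p q n j l <-> cos (lead_angle p q n j) = cos (lead_angle p q n l).
Proof.
  unfold stokes_line.
  replace ((omega_exp p q j - omega_exp p q l) * Cexp (Ci * INR (p + q) * chi p q n))%C
    with (Cexp (Ci * lead_angle p q n j) - Cexp (Ci * lead_angle p q n l))%C
    by (rewrite <- !omega_exp_Cexp; ring).
  change (Re (?a - ?b)%C) with (Re a - Re b). rewrite !Re_Cexp_i. lra.
Qed.

(** The part of the leading coefficient that does not involve [beta]. Being positive, it lets the
    keys decide the order. *)
Let kappa : R := INR p * Rpower mu ((INR p + INR q) / (2 * INR p)) / 2 / INR (p + q).

Let kappa_pos : 0 < kappa.
Proof.
  unfold kappa. repeat apply Rdiv_lt_0_compat; try lra.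
  apply Rmult_lt_0_compat; [lra | apply exp_pos].
Qed.

Lemma phi_key_lim (tau : C -> C) (n : Z) (theta : R) (j : nat) :
  is_tau p mu tau ->
  is_lim (fun rho => 2 * exp (- (INR (p + q) * Re (tau (ray theta rho)))) *
            Re (phi p q beta mu j (tau (ray theta rho))))
    p_infty (kappa * profile_key p q beta n (INR (p + q) * (chi p q n - theta)) j).
Proof.
  intro htau.
  replace (kappa * profile_key p q beta n (INR (p + q) * (chi p q n - theta)) j)
    with (phi_coeff p q beta mu * (cos (INR (p + q) * (theta - shift p j)) / INR (p + q))).
  - now apply phi_ray_lim.
  - unfold profile_key, kappa, phi_coeff.
    replace (lead_angle p q n j - INR (p + q) * (chi p q n - theta))
      with (INR (p + q) * (theta - shift p j)); [field; lra|].
    unfold lead_angle, chi, shift.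
    rewrite minus_IZR, !mult_IZR, <- !INR_IZR_INZ. field. lra.
Qed.

Lemma phi_eventually_lt (tau : C -> C) (n : Z) (theta : R) (j l : nat) :
  is_tau p mu tau ->
  profile_key p q beta n (INR (p + q) * (chi p q n - theta)) j <
    profile_key p q beta n (INR (p + q) * (chi p q n - theta)) l ->
  Rbar_locally p_infty (fun rho =>
    Re (phi p q beta mu j (tau (ray theta rho))) < Re (phi p q beta mu l (tau (ray theta rho)))).
Proof.
  intros htau H.
  generalize (eventually_lt _ _ _ _ (phi_key_lim tau n theta j htau)
    (phi_key_lim tau n theta l htau) ltac:(nra)).
  apply filter_imp. intros rho Hrho. eapply Rmult_lt_reg_l; [|exact Hrho].
  apply Rmult_lt_0_compat; [lra | apply exp_pos].
Qed.

Lemma sector_delta (n : Z) (theta : R) :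
  chi p q n - PI / (INR (p + q) * INR p) < theta < chi p q n ->
  0 < INR (p + q) * (chi p q n - theta) < PI / INR p.
Proof.
  intros [H1 H2]. split; [apply Rmult_lt_0_compat; lra|].
  replace (PI / INR p) with (INR (p + q) * (PI / (INR (p + q) * INR p))) by (field; lra).
  apply Rmult_lt_compat_l; lra.
Qed.

Lemma half_step : 0 < PI / (2 * INR p) < PI / INR p.
Proof.
  assert (Hpi := PI_RGT_0). split; [apply Rdiv_lt_0_compat; lra|].
  replace (PI / INR p) with (2 * (PI / (2 * INR p))) by (field; lra).
  enough (0 < PI / (2 * INR p)) by lra. apply Rdiv_lt_0_compat; lra.
Qed.

Lemma sin_step_pos (delta : R) : 0 < delta < PI / INR p -> 0 < sin delta.
Proof.
  intros Hd. apply sin_gt_0; [lra|]. apply Rlt_le_trans with (1 := proj2 Hd).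
  assert (1 <= INR p) by (rewrite <- INR_1; apply le_INR; lia).
  assert (Hpi := PI_RGT_0). apply Rmult_le_reg_r with (INR p); [lra|].
  replace (PI / INR p * INR p) with PI by (field; lra). nra.
Qed.

(** One ray suffices: adjacency in the arrangement gives an inequality of keys there, and
    [key_reflected] converts it into the sign of [beta * sin (lead_angle p q n j)]. *)
Lemma parenthesis_neighbours (n : Z) (j l : nat) :
  (1 <= j <= p)%nat -> (1 <= l <= p)%nat ->
  parenthesis p q beta mu n j l -> neighbours p q beta n j l.
Proof.
  intros hj hl [[J [[HJ [tau [htau Htheta]]] [J1 [J2 ->]]]] Hst].
  assert (Hjl : j <> l).
  { intros <-. apply Permutation_sym, Permutation_NoDup in HJ; [|apply seq_NoDup].
    apply NoDup_remove_2 in HJ. apply HJ, in_or_app. right. now left. }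
  assert (Href : reflected p q n j l).
  { apply reflected_cos; try assumption. now apply stokes_line_cos. }
  split; [exact Href|].
  assert (Hr : 0 < INR (p + q)) by lra.
  (* The bisecting ray of the sector, where the angular offset [delta] is [PI / (2 p)]. *)
  set (theta := chi p q n - PI / (2 * INR p) / INR (p + q)).
  assert (Edelta : INR (p + q) * (chi p q n - theta) = PI / (2 * INR p))
    by (unfold theta; field; lra).
  assert (Hhalf := half_step).
  assert (Hs : chi p q n - PI / (INR (p + q) * INR p) < theta < chi p q n).
  { unfold theta. replace (PI / (INR (p + q) * INR p)) with (PI / INR p / INR (p + q)) by (field; lra).
    split.
    - apply Rplus_lt_compat_l, Ropp_lt_contravar. apply Rmult_lt_compat_r; [|lra].
      now apply Rinv_0_lt_compat.
    - enough (0 < PI / (2 * INR p) / INR (p + q)) by lra. apply Rdiv_lt_0_compat; lra. }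
  specialize (Htheta theta Hs).
  assert (Hle : kappa * profile_key p q beta n (PI / (2 * INR p)) j <=
      (* Limits preserve only the weak inequality; strictness returns below because the sine of a
         reflected angle does not vanish. *)
      kappa * profile_key p q beta n (PI / (2 * INR p)) l).
  { rewrite <- Edelta.
    refine (is_lim_le_loc _ _ p_infty _ _ _ (phi_key_lim tau n theta j htau)
      (phi_key_lim tau n theta l htau)).
    eapply filter_imp; [|exact Htheta]. cbv beta zeta. intros rho Hrho.
    apply Sorted_adjacent_rel in Hrho. apply Rmult_le_compat_l; [|now left].
    left. apply Rmult_lt_0_compat; [lra | apply exp_pos]. }
  apply Rmult_le_reg_l in Hle; [|exact kappa_pos].
  assert (E := key_reflected p q beta n (PI / (2 * INR p)) j l Href).
  assert (S := sin_step_pos _ Hhalf).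
  assert (N : beta * sin (lead_angle p q n j) <> 0).
  { apply Rmult_integral_contrapositive_currified; [exact hbeta|].
    now apply reflected_sin_neq0 with l. }
  nra.
Qed.

(** The arrangement is obtained by sorting the keys on the bisecting ray; [key_order] carries it to
    every ray of the sector, and [key_no_between] makes [j] and [l] adjacent in it. *)
Lemma neighbours_parenthesis (n : Z) (j l : nat) :
  0 < mu -> (1 <= j <= p)%nat -> (1 <= l <= p)%nat ->
  neighbours p q beta n j l -> parenthesis p q beta mu n j l.
Proof.
  intros hmu hj hl Hn. assert (Hjl := neighbours_neq p q beta n j l Hn).
  destruct Hn as [Href Hsin]. assert (Hhalf := half_step).
  split; [|now apply stokes_line_cos, reflected_cos].
  set (f := profile_key p q beta n (PI / (2 * INR p))).
  destruct (sort_exists nat f (seq 1 p)) as [J [HJ Hs]].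
  { apply seq_NoDup. }
  { intros x y Hx Hy Hxy. apply in_seq in Hx, Hy. apply key_inj; try assumption; lia. }
  assert (HinJ : forall x, In x J <-> (1 <= x <= p)%nat).
  { intro x. transitivity (In x (seq 1 p)); [|rewrite in_seq; lia].
    split; apply Permutation_in; [now symmetry | assumption]. }
  exists J. split.
  - split; [now symmetry|]. exists (tau_inf p mu).
    assert (htau := tau_inf_is_tau p mu hp hmu). split; [exact htau|].
    intros theta Htheta. apply sector_delta in Htheta.
    apply (eventually_Sorted (fun x y => f x < f y)
      (fun rho x y => Re (phi p q beta mu x (tau_inf p mu (ray theta rho))) <
         Re (phi p q beta mu y (tau_inf p mu (ray theta rho))))).
    + now apply StronglySorted_Sorted.
    + intros x y _ _ Hxy. apply phi_eventually_lt with n; [exact htau|].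
      revert Hxy. now apply key_order.
  - apply (sorted_adjacent nat f); try now apply HinJ.
    + exact Hs.
    + assert (E := key_reflected p q beta n (PI / (2 * INR p)) j l Href).
      assert (S := sin_step_pos _ Hhalf). unfold f. nra.
    + intros z _. now apply key_no_between.
Qed.

(** Differentiation cancels the denominators [p + q] and [q - p]. On the imaginary axis, with
    [s = x - shift p j], what remains is [sin ((p + q) s) - sin ((q - p) s) = 2 cos (q s) sin (p
    s)]. *)
Lemma Cderiv_phi (j : nat) (x : R) :
  Cderiv (phi p q beta mu j) (x * Ci)
    (2 * phi_coeff p q beta mu * cos (INR q * (x - shift p j)) * sin (INR p * (x - shift p j)) * Ci).
Proof.
  set (z := (x * Ci)%C). set (r := INR p + INR q). set (d := INR q - INR p).
  assert (Hr : r <> 0) by (unfold r; lra).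
  assert (Hd : d <> 0) by (unfold d; intro E; apply hneq, INR_eq; lra).
  assert (H1 := Cderiv_scal _ _ _ (/ r)%R (Cderiv_Ccosh_affine z r (shift p j * Ci))).
  assert (H2 := Cderiv_scal _ _ _ (/ d)%R (Cderiv_Ccosh_affine z d (shift p j * Ci))).
  assert (H := Cderiv_scal _ _ _ (phi_coeff p q beta mu) (Cderiv_minus _ _ _ _ _ H1 H2)).
  assert (S : forall k : R, ((Cexp (k * (z - shift p j * Ci)) - Cexp (- (k * (z - shift p j * Ci)))) / 2)%C
                = (sin (k * (x - shift p j)) * Ci)%C).
  { intro k. replace (k * (z - shift p j * Ci))%C with (Ci * (k * (x - shift p j))%R)%C
      by (unfold z; rewrite RtoC_mult, RtoC_minus; ring).
    replace (- (Ci * (k * (x - shift p j))%R))%C with (Ci * (- (k * (x - shift p j)))%R)%C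
      by (rewrite RtoC_opp; ring).
    rewrite Cdiv_R by lra.
    apply C_ext; rewrite ?Re_scale, ?Im_scale;
      change (Re (?a - ?b)%C) with (Re a - Re b);
      change (Im (?a - ?b)%C) with (Im a - Im b);
      rewrite ?Re_Cexp_i, ?Im_Cexp_i, ?cos_neg, ?sin_neg; simpl; field. }
  rewrite !S in H.
  replace (2 * phi_coeff p q beta mu * cos (INR q * (x - shift p j)) * sin (INR p * (x - shift p j)) * Ci)%C
    with (phi_coeff p q beta mu * ((/ r)%R * (r * (sin (r * (x - shift p j)) * Ci)) -
       (/ d)%R * (d * (sin (d * (x - shift p j)) * Ci))))%C.
  - intros eps Heps. destruct (H eps Heps) as [e [He H']]. exists e. split; [exact He|].
    intros y Hy. specialize (H' y Hy). now rewrite !phi_eq by assumption.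
  - rewrite !RtoC_inv by assumption.
    replace (sin (r * (x - shift p j)))
      with (2 * (cos (INR q * (x - shift p j)) * sin (INR p * (x - shift p j)))
            + sin (d * (x - shift p j))).
    + rewrite RtoC_plus, !RtoC_mult. field. split; now apply RtoC_neq_0.
    + unfold r, d.
      replace ((INR p + INR q) * (x - shift p j))
        with (INR q * (x - shift p j) + INR p * (x - shift p j)) by ring.
      replace ((INR q - INR p) * (x - shift p j))
        with (INR q * (x - shift p j) - INR p * (x - shift p j)) by ring.
      rewrite sin_plus, sin_minus. ring.
Qed.


(** * Critical points and critical values at [tau_at] *)

Section CriticalPoint.

Variables (a b : Z).
Hypothesis hb : (0 < b < Z.of_nat q)%Z.

Let n : Z := (a * Z.of_nat (p + q) + b)%Z.
Let L : Z := (a * Z.of_nat q + b)%Z.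
Let x : R := IZR L / (INR p * INR q) * PI.
(** The sign [(-1)^a]. *)
Let sg : R := cos (IZR a * PI).
Let theta (j : nat) : R := INR q * (x - shift p j).

Let tau_at_eq : tau_at p q L = (x * Ci)%C.
Proof.
  unfold tau_at, x. rewrite RtoC_mult, RtoC_div, RtoC_mult; [reflexivity|].
  apply Rgt_not_eq, Rmult_lt_0_compat; lra.
Qed.

(** Since [n - L = a p] and [(p + q) - q = p], the denominator [p] cancels and the difference of the
    two angles is an integer multiple of [PI] with the parity of [a]. *)
Let angle_theta (j : nat) :
  lead_angle p q n j = theta j + IZR (a + 2 * - Z.of_nat (j - 1)) * PI.
Proof.
  unfold lead_angle, theta, x, shift, n, L.
  rewrite minus_IZR, !plus_IZR, !mult_IZR, !opp_IZR, <- !INR_IZR_INZ, INRr.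
  field. lra.
Qed.

Let sign_shift (m : Z) : cos (IZR (a + 2 * m) * PI) = sg.
Proof.
  rewrite plus_IZR, Rmult_plus_distr_r, cos_shift_PI, cos_IZR_2PI. apply Rmult_1_l.
Qed.

Let cos_angle (j : nat) : cos (lead_angle p q n j) = sg * cos (theta j).
Proof. now rewrite angle_theta, cos_shift_PI, sign_shift. Qed.

Let sin_angle (j : nat) : sin (lead_angle p q n j) = sg * sin (theta j).
Proof. now rewrite angle_theta, sin_shift_PI, sign_shift. Qed.

Let sg_sqr : sg * sg = 1.
Proof. apply cos_IZR_PI_sqr. Qed.

Let psi (j : nat) : INR p * (x - shift p j) = INR p * x + IZR (2 * - Z.of_nat (j - 1)) * PI.
Proof.
  unfold shift. rewrite mult_IZR, opp_IZR, <- INR_IZR_INZ. field. lra.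
Qed.

(** Here [p x = PI L / q] is [a PI + PI b / q]. The condition [0 < b < q] then makes this sine
    nonzero, so only the cosine factor of the derivative can produce critical points. *)
Let sin_px : sin (INR p * x) = sg * sin (PI * IZR b / INR q).
Proof.
  replace (INR p * x) with (PI * IZR b / INR q + IZR a * PI).
  - apply sin_shift_PI.
  - unfold x, L. rewrite plus_IZR, mult_IZR, <- INR_IZR_INZ. field. lra.
Qed.

Let sin_b_pos : 0 < sin (PI * IZR b / INR q).
Proof.
  assert (Hpi := PI_RGT_0). destruct hb as [hb1 hb2]. apply IZR_lt in hb1, hb2.
  rewrite <- INR_IZR_INZ in hb2. apply sin_gt_0.
  - apply Rdiv_lt_0_compat; [now apply Rmult_lt_0_compat | lra].
  - apply Rmult_lt_reg_r with (INR q); [lra|].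
    replace (PI * IZR b / INR q * INR q) with (PI * IZR b) by (field; lra).
    now apply Rmult_lt_compat_l.
Qed.

Let sin_psi (j : nat) : sin (INR p * (x - shift p j)) = sin (INR p * x).
Proof. rewrite psi, sin_shift_PI, cos_IZR_2PI. apply Rmult_1_l. Qed.

Let cos_psi (j : nat) : cos (INR p * (x - shift p j)) = cos (INR p * x).
Proof. rewrite psi, cos_shift_PI, cos_IZR_2PI. apply Rmult_1_l. Qed.

Let coeff_neq0 : phi_coeff p q beta mu <> 0.
Proof.
  unfold phi_coeff, Rdiv. repeat apply Rmult_integral_contrapositive_currified; try lra.
  apply Rgt_not_eq, exp_pos.
Qed.

(** The factor [sin (p (x - shift p j))] is the same for all indices and nonzero, so the derivative
    vanishes exactly when the cosines of [theta l] and [theta j] agree. Multiplying by [sg] passes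
    to the leading angles. *)
Lemma phi2_critical (j l : nat) :
  is_derive (K := C_AbsRing) (V := C_NormedModule) (phi2 p q beta mu l j) (tau_at p q L) (RtoC 0)
  <-> cos (lead_angle p q n j) = cos (lead_angle p q n l).
Proof.
  assert (H := Cderiv_is_derive _ _ _ (Cderiv_minus _ _ _ _ _ (Cderiv_phi l x) (Cderiv_phi j x))).
  rewrite !sin_psi in H. fold (theta l) (theta j) in H.
  set (D := ((_ - _)%C : C)) in H.
  assert (ED : D = ((2 * phi_coeff p q beta mu * sin (INR p * x) * (cos (theta l) - cos (theta j)))%R * Ci)%C).
  { unfold D. rewrite !RtoC_mult, RtoC_minus. ring. }
  rewrite tau_at_eq, !cos_angle. split.
  - intro H0. apply is_C_derive_unique in H. apply is_C_derive_unique in H0.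
    assert (D0 : D = 0) by (rewrite <- H; exact H0).
    rewrite ED in D0. apply (f_equal Im) in D0. rewrite Im_scale in D0. simpl in D0.
    rewrite Rmult_1_r, sin_px in D0.
    apply Rmult_integral in D0. destruct D0 as [D0|D0].
    + exfalso. assert (Hsg : sg <> 0) by (intro E; rewrite E in sg_sqr; lra).
      apply Rmult_integral in D0. destruct D0 as [D0|D0];
        apply Rmult_integral in D0; destruct D0; lra || contradiction.
    + f_equal. lra.
  - intro Hc. replace (RtoC 0) with D; [exact H|]. rewrite ED.
    replace (cos (theta l) - cos (theta j)) with 0; [rewrite Rmult_0_r; ring|].
    apply Rmult_eq_reg_l with sg; [lra|]. intro E. rewrite E in sg_sqr. lra.
Qed.

(** Reflection keeps [cos (theta j)] and reverses [sin (theta j)], so only sine products survive.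
    Their coefficients add up to [1 / (p + q) + 1 / (q - p) = 2 q / ((p + q) (q - p))], which is
    where the sign of [q - p] enters. *)
Lemma phi2_critical_value (j l : nat) :
  reflected p q n j l ->
  Re (phi2 p q beta mu l j (tau_at p q L)) * (INR q - INR p) =
  4 * phi_coeff p q beta mu * INR q / (INR p + INR q) * sin (PI * IZR b / INR q)
    * sin (lead_angle p q n j).
Proof.
  intros Hr.
  assert (Hd : INR q - INR p <> 0) by (intro E; apply hneq, INR_eq; lra).
  assert (Hc : cos (theta l) = cos (theta j) /\ sin (theta l) = - sin (theta j)).
  { destruct Hr as [d Hr].
    assert (E : lead_angle p q n l = - lead_angle p q n j + IZR (2 * d) * PI) by lra.
    assert (Ec := cos_angle l). assert (Es := sin_angle l).
    rewrite E, cos_shift_PI, cos_IZR_2PI, cos_neg, cos_angle in Ec.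
    rewrite E, sin_shift_PI, cos_IZR_2PI, sin_neg, sin_angle in Es.
    assert (sg <> 0) by (intro E'; rewrite E' in sg_sqr; lra).
    split; apply Rmult_eq_reg_l with sg; lra. }
  destruct Hc as [Hc Hs].
  unfold phi2. change (Re (?u - ?v)%C) with (Re u - Re v).
  rewrite tau_at_eq, !Re_phi by assumption.
  replace (Re (x * Ci)) with 0 by (simpl; ring).
  replace (Im (x * Ci)) with x by (simpl; ring).
  rewrite !Rmult_0_r, cosh_0, !(Rmult_plus_distr_r (INR p)), !(Rmult_minus_distr_r (INR q)).
  fold (theta l) (theta j).
  rewrite !cos_plus, !cos_minus, !sin_psi, !cos_psi, Hc, Hs, sin_px, sin_angle.
  field. lra.
Qed.

Lemma Im_phi2_tau_at (j l : nat) : Im (phi2 p q beta mu l j (tau_at p q L)) = 0.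
Proof.
  unfold phi2. change (Im (?u - ?v)%C) with (Im u - Im v).
  rewrite tau_at_eq, !Im_phi by assumption.
  replace (Re (x * Ci)) with 0 by (simpl; ring).
  rewrite !Rmult_0_r, sinh_0. unfold Rdiv. ring.
Qed.

Lemma neighbours_critical (j l : nat) :
  (1 <= j <= p)%nat -> (1 <= l <= p)%nat ->
  neighbours p q beta n j l <->
  is_derive (K := C_AbsRing) (V := C_NormedModule) (phi2 p q beta mu l j) (tau_at p q L) (RtoC 0)
  /\ Re (phi2 p q beta mu l j (tau_at p q L)) * (INR q - INR p) < 0.
Proof.
  intros hj hl. rewrite phi2_critical.
  set (c := 4 * kappa * INR q * sin (PI * IZR b / INR q)).
  assert (Hc : 0 < c) by (unfold c; repeat (apply Rmult_lt_0_compat; [|assumption]); lra).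
  assert (Hv : reflected p q n j l ->
    Re (phi2 p q beta mu l j (tau_at p q L)) * (INR q - INR p) = c * (beta * sin (lead_angle p q n j))).
  { intro Hr. rewrite phi2_critical_value by exact Hr.
    unfold c, kappa, phi_coeff. rewrite INRr. field. lra. }
  split.
  - intros Hn. assert (Hjl := neighbours_neq p q beta n j l Hn).
    destruct Hn as [Hr Hs]. split; [now apply reflected_cos|]. rewrite Hv by exact Hr. nra.
  - intros [Hcos Hneg].
    (* Equal indices satisfy the critical point condition trivially; the strict sign of the value
       rules them out. *)
    assert (Hjl : j <> l).
    { intros ->. unfold phi2 in Hneg. change (Re (?u - ?v)%C) with (Re u - Re v) in Hneg.
      rewrite Rminus_diag in Hneg. lra. }
    assert (Hr : reflected p q n j l) by now apply reflected_cos.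
    split; [exact Hr|]. rewrite Hv in Hneg by exact Hr. nra.
Qed.

End CriticalPoint.

End Main.

Theorem theorem4p5 (p q : nat) (beta mu : R)
    (hp : (2 <= p)%nat) (hq : (1 <= q)%nat) (hpq : Nat.gcd p q = 1%nat)
    (hbeta : beta <> 0) (hmu : 0 < mu)
    (a b : Z) (hb : (0 < b < Z.of_nat q)%Z) :
  ((p < q)%nat ->
     forall j l : nat, (1 <= j <= p)%nat -> (1 <= l <= p)%nat ->
       (parenthesis p q beta mu (a * Z.of_nat (p + q) + b)%Z j l <->
        is_derive (K := C_AbsRing) (V := C_NormedModule)
          (phi2 p q beta mu l j)
          (tau_at p q (a * Z.of_nat q + b)) (RtoC 0)
        /\ Cnegative (phi2 p q beta mu l j
             (tau_at p q (a * Z.of_nat q + b)))))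
  /\
  ((q < p)%nat ->
     forall j l : nat, (1 <= j <= p)%nat -> (1 <= l <= p)%nat ->
       (parenthesis p q beta mu (a * Z.of_nat (p + q) + b)%Z j l <->
        is_derive (K := C_AbsRing) (V := C_NormedModule)
          (phi2 p q beta mu l j)
          (tau_at p q (a * Z.of_nat q + b)) (RtoC 0)
        /\ Cpositive (phi2 p q beta mu l j
             (tau_at p q (a * Z.of_nat q + b))))).
Proof.
  assert (hp1 : (1 <= p)%nat) by lia.
  (* Multiplying the value by [q - p] merges the two cases into one equivalence; they are separated
     at the end by the sign of this factor. *)
  assert (main : p <> q -> forall j l : nat, (1 <= j <= p)%nat -> (1 <= l <= p)%nat ->
    parenthesis p q beta mu (a * Z.of_nat (p + q) + b)%Z j l <->
    is_derive (K := C_AbsRing) (V := C_NormedModule) (phi2 p q beta mu l j)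
      (tau_at p q (a * Z.of_nat q + b)) (RtoC 0)
    /\ Re (phi2 p q beta mu l j (tau_at p q (a * Z.of_nat q + b))) * (INR q - INR p) < 0).
  { intros hneq j l hj hl. rewrite <- neighbours_critical by assumption.
    split; [now apply parenthesis_neighbours | now apply neighbours_parenthesis]. }
  split; intros hlt j l hj hl; assert (hneq : p <> q) by lia; rewrite main by assumption;
    apply lt_INR in hlt; unfold Cnegative, Cpositive;
    rewrite Im_phi2_tau_at by assumption;
    set (v := Re _); (split; intros [Hder Hv]; (split; [exact Hder|]));
    [split; [reflexivity|] | destruct Hv as [_ Hv]
    |split; [reflexivity|] | destruct Hv as [_ Hv]]; nra.
Qed.
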